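(* Let $N\ge 2$ and $k,T>0$, and let $\mathcal{G}=(L_1,\dots,L_{N-1},\mu_1^+,\mu_1^-,\dots,\mu_N^+,\mu_N^-)$ be a $T$-periodic gait (as defined in the context). Let $t_0\in\mathbb{R}$. Then there exists a real number $v_0(\mathcal{G})$ (the average asymptotic velocity of the gait) such that every solution $x\colon[t_0,+\infty)\to\mathbb{R}^N$ of $$0\in D_x\mathcal{E}(t,x)+\partial_{\dot x}\mathcal{R}(t,\dot x)$$ with admissible initial state $x(t_0)$ satisfies $$\lim_{t\to+\infty}\frac{\pi_Y(x(t))-\pi_Y(x(t_0))}{t-t_0}=v_0(\mathcal{G});$$ in particular $v_0(\mathcal{G})$ does not depend on the admissible initial state. Moreover, for every such solution $x$ there exists a running-periodic solution $\bar x=(\bar x_1,\dots,\bar x_N)$ of the same inclusion, that is, a solution of the form $$\bar x_i(t)=\bar x_0+(t-t_0)\,v_0(\mathcal{G})+\bar p_i(t),\qquad i=1,\dots,N,$$ with $\bar x_0\in\mathbb{R}$ (possibly depending on $x(t_0)$) and $\bar p_i$ $T$-periodic, such that $$\lim_{q\to\infty}\|x(\cdot+qT)-\bar x(\cdot+qT)\|_{W^{1,2}([t_0,t_0+T];\mathbb{R}^N)}=0,$$ where $q$ ranges over the positive integers.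
   Context: A gait consists of Lipschitz continuous $T$-periodic functions $L_1,\dots,L_{N-1}\colon\mathbb{R}\to\mathbb{R}$ and $\mu_i^\pm\colon\mathbb{R}\to\mathbb{R}$ ($i=1,\dots,N$) such that: (i) there are constants $\alpha_1,\alpha_2>0$ with $\alpha_1\le\mu_i^\pm(t)\le\alpha_2$ for all $t$, $i$ and both signs; (ii) for every subset $J\subseteq\{1,\dots,N\}$, with complement $J^c$, one has $\sum_{i\in J}\mu_i^+(t)-\sum_{i\in J^c}\mu_i^-(t)\neq0$ for almost every $t$. The energy is $\mathcal{E}(t,x)=\sum_{i=1}^{N-1}\frac{k}{2}(x_{i+1}-x_i-L_i(t))^2$ for $x\in\mathbb{R}^N$. The dissipation potential is $\mathcal{R}(t,u)=\sum_{i=1}^N\mathcal{R}_i(t,u_i)$ with $\mathcal{R}_i(t,u_i)=-\mu_i^-(t)u_i$ if $u_i\le0$ and $\mathcal{R}_i(t,u_i)=\mu_i^+(t)u_i$ if $u_i\ge0$. $D_x\mathcal{E}$ is the gradient in $x$, and $\partial_{\dot x}\mathcal{R}$ is the convex subdifferential in the second variable. A solution is a (locally) absolutely continuous function satisfying the inclusion for a.e. $t$. Set $C(t)=\partial_{\dot x}\mathcal{R}(t,0)=\{\xi\in\mathbb{R}^N:-\mu_i^-(t)\le\xi_i\le\mu_i^+(t),\ i=1,\dots,N\}$. An initial state $x_0$ at time $t_0$ is admissible if $-D_x\mathcal{E}(t_0,x_0)\in C(t_0)$. Finally, $\pi_Y(x)=\frac1N\sum_{i=1}^Nx_i$. *)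

(* Defs.v *)
From mathcomp Require Import all_boot all_order all_algebra.
From mathcomp Require Import all_classical all_reals all_analysis.
Import Order.TTheory GRing.Theory Num.Theory.
Import numFieldNormedType.Exports.

Set Implicit Arguments.
Unset Strict Implicit.
Unset Printing Implicit Defensive.

Local Open Scope classical_set_scope.
Local Open Scope ring_scope.

Section VectorCalculus.
Context {R : realType} {N : nat}.
Implicit Types (u v xi : 'rV[R]_N) (f : 'rV[R]_N -> R).

Definition dotv u v : R := \sum_i u 0 i * v 0 i.

Definition gradient f u : 'rV[R]_N := \row_i 'D_(delta_mx 0 i) f u.

Definition subdifferential f u : set 'rV[R]_N :=
  [set xi | forall v, f u + dotv xi (v - u) <= f v].

Definition piY u : R := N%:R^-1 * \sum_i u 0 i.

(* [f] is meant to be absolutely continuous on `[a, b]; its weak derivative is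
   then its almost everywhere defined classical derivative. The norm of R^N is
   the Euclidean one, not the max norm carried by 'rV[R]_N. *)
Definition W12norm (a b : R) (f : R -> 'rV[R]_N) : \bar R :=
  sqrte (\int[lebesgue_measure]_(t in `[a, b])
    (dotv (f t) (f t) + dotv (derive1 f t) (derive1 f t))%:E)%E.

End VectorCalculus.

Definition abs_cont {R : realType} {V : normedModType R} (a b : R)
    (f : R -> V) : Prop :=
  forall e : R, 0 < e -> exists2 d : R, 0 < d &
    forall (n : nat) (u v : 'I_n -> R),
      (forall i, [/\ a <= u i, u i <= v i & v i <= b]) ->
      trivIset setT (fun i => `]u i, v i[%classic) ->
      \sum_i (v i - u i) < d ->
      \sum_i `|f (v i) - f (u i)| < e.

Definition loc_abs_cont {R : realType} {V : normedModType R} (a : R)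
    (f : R -> V) : Prop :=
  forall b : R, a <= b -> abs_cont a b f.

Record gait (R : realType) (N : nat) (T : R) := Gait {
  gL : 'I_N.-1 -> R -> R;
  gmup : 'I_N -> R -> R;
  gmum : 'I_N -> R -> R;
  gL_lipschitz : forall i, lipschitz (gL i);
  gmup_lipschitz : forall i, lipschitz (gmup i);
  gmum_lipschitz : forall i, lipschitz (gmum i);
  gL_periodic : forall i, periodic (gL i) T;
  gmup_periodic : forall i, periodic (gmup i) T;
  gmum_periodic : forall i, periodic (gmum i) T;
  gmu_bounds : exists alpha1 alpha2 : R, [/\ 0 < alpha1, 0 < alpha2 &
    forall i t, alpha1 <= gmup i t <= alpha2 /\ alpha1 <= gmum i t <= alpha2];
  gmu_neq0 : forall J : {set 'I_N}, {ae lebesgue_measure, forall t : R,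
    \sum_(i in J) gmup i t - \sum_(i in ~: J) gmum i t != 0}
}.

Section Crawler.
Context {R : realType} {N : nat} {T : R}.
Variables (k : R) (G : gait N T).
Implicit Types (t : R) (u x : 'rV[R]_N).

Lemma ord_next_subproof (i : 'I_N.-1) : (i.+1 < N)%N.
Proof. by rewrite -ltn_predRL. Qed.

Definition ord_this (i : 'I_N.-1) : 'I_N := widen_ord (leq_pred N) i.
Definition ord_next (i : 'I_N.-1) : 'I_N := Ordinal (ord_next_subproof i).

Definition energy t x : R :=
  \sum_i k / 2 * (x 0 (ord_next i) - x 0 (ord_this i) - gL G i t) ^+ 2.

Definition dissipation1 (i : 'I_N) t (w : R) : R :=
  if w <= 0 then - gmum G i t * w else gmup G i t * w.

Definition dissipation t u : R := \sum_i dissipation1 i t (u 0 i).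

Definition stable_set t : set 'rV[R]_N := subdifferential (dissipation t) 0.

Lemma stable_setE t : stable_set t =
  [set xi | forall i, - gmum G i t <= xi 0 i <= gmup G i t].
Proof.
have d0 i : dissipation1 i t 0 = 0 by rewrite /dissipation1 lexx mulr0.
have D0 : dissipation t 0 = 0 by rewrite /dissipation big1// => i _; rewrite mxE.
apply/seteqP; split => xi /= Hxi.
- move=> i; have key w : xi 0 i * w <= dissipation1 i t w.
    have := Hxi (w *: delta_mx 0 i); rewrite D0 add0r subr0 /dotv /dissipation.
    rewrite (bigD1 i)//= [leRHS](bigD1 i)//= !mxE !eqxx mulr1 !big1 ?addr0//.
      by move=> j /negbTE ji; rewrite !mxE ji mulr0 d0.
    by move=> j /negbTE ji; rewrite !mxE ji !mulr0.
  have := key 1; have := key (-1).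
  by rewrite /dissipation1 lerN10 ler10 !mulrN1 opprK !mulr1 lerNl => -> ->.
- move=> v; rewrite D0 add0r subr0.
  apply: ler_sum => i _; have /andP[lo hi] := Hxi i; rewrite /dissipation1.
  case: ifPn => [v0|]; first by rewrite ler_wnM2r.
  by rewrite -ltNge => /ltW v0; rewrite ler_wpM2r.
Qed.

Definition admissible t0 x0 : Prop := stable_set t0 (- gradient (energy t0) x0).

(* Only the values of [x] on [t0, +oo) matter: the derivative at [t] depends on
   the germ of [x] at [t], and [t = t0] is negligible. *)
Definition solution (t0 : R) (x : R -> 'rV[R]_N) : Prop :=
  loc_abs_cont t0 x /\
  {ae lebesgue_measure, forall t, t0 <= t -> derivable x t 1 /\
    [set gradient (energy t) (x t) + xi
       | xi in subdifferential (dissipation t) (derive1 x t)] 0}.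

End Crawler.

Definition running_periodic {R : realType} {N : nat} (T t0 v : R)
    (x : R -> 'rV[R]_N) : Prop :=
  exists (x0 : R) (p : 'I_N -> R -> R),
    (forall i, periodic (p i) T) /\
    forall t, t0 <= t -> forall i, x t 0 i = x0 + (t - t0) * v + p i t.

(* Main.v *)
(* Let D be the difference matrix of the chain, so that the forces of two motions
   x and y differ by -k D^T D d, where d = x - y. Friction is monotone, hence
   (D^T D d)_i d_i' <= 0 for every body i. Two quantities therefore do not
   increase: the energy |D d|^2 and, D^T D being an M-matrix, the maximum of the
   d_i. Condition (ii) on the gait excludes that all d_i' are positive.
   The shifts of x by multiples of the period, recentred, have a limit z along an
   ultrafilter, and z solves the inclusion. The energy of z(. + T) - z is constant
   in time; equality in the monotonicity argument then makes z(. + T) - z itself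
   constant, i.e. z is running-periodic. The maximum and the minimum of x - z are
   monotone and their difference tends to 0, so x - z converges to a constant.
   For the velocities, u = x' and w = z', at almost every time either the forces
   of z are close to, but different from, a friction bound, which is a set of small
   measure, or the sum of the u_i (D^T D (u - w))_i is 0, so that
   |D (u - w)|^2 = - (D w).(D (u - w)). The integral of the right-hand side tends
   to 0 because u - w tends to 0 weakly. *)

(* No existence theorem enters: [z] is extracted from a given solution, and [v0] is the velocity of
   the limit of one chosen solution. Any other solution stays at bounded distance from it, by
   monotonicity of the maxima of both differences, and so has the same velocity. Two obstacles shape
   the proof. A solution is only absolutely continuous, and the inclusion involves derivatives, so
   it does not pass to pointwise limits. Hence the a priori speed bound, which makes solutions
   Lipschitz, and the reformulation [crawling], which speaks of increments only. Also, a maximum of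
   finitely many coordinates need not be differentiable, so differential inequalities are integrated
   from Dini bounds. For the velocities, weak convergence is made quantitative: D w is replaced by
   difference quotients, which are Lipschitz in time and can be integrated by parts against D (u -
   w). Their Lipschitz constant grows with the fineness [n], so [n] is fixed before the required
   closeness of the motions. *)
Require Import Defs.
From HB Require Import structures.
From mathcomp Require Import all_boot all_order all_algebra.
From mathcomp Require Import all_classical all_reals all_analysis.
From mathcomp Require Import measurable_realfun.
From mathcomp Require Import ring lra.
Import Order.TTheory GRing.Theory Num.Theory.
Import numFieldNormedType.Exports.
Local Open Scope classical_set_scope.
Local Open Scope ring_scope.

(** * Absolutely continuous functions and Dini derivatives *)

Section ae_lebesgue.
Context {R : realType}.
Implicit Types P Q : R -> Prop.

Lemma ae_mono P Q : (forall t, P t -> Q t) ->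
  {ae lebesgue_measure, forall t, P t} -> {ae lebesgue_measure, forall t, Q t}.
Proof.
move=> PQ [E [mE E0 sE]]; exists E; split => // t /= nQ; apply: sE => /=.
by apply: contra_not nQ; exact: PQ.
Qed.

Lemma ae_conj P Q :
  {ae lebesgue_measure, forall t, P t} -> {ae lebesgue_measure, forall t, Q t} ->
  {ae lebesgue_measure, forall t, P t /\ Q t}.
Proof.
move=> [E [mE E0 sE]] [F [mF F0 sF]]; exists (E `|` F); split.
- exact: measurableU.
- by rewrite measureU0.
- move=> t /= nPQ; have [Pt|nPt] := pselect (P t); last by left; exact: sE.
  by right; apply: sF => /= Qt; apply: nPQ.
Qed.

Lemma ae_forall_fin (I : finType) (P : I -> R -> Prop) :
  (forall i, {ae lebesgue_measure, forall t, P i t}) ->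
  {ae lebesgue_measure, forall t, forall i, P i t}.
Proof.
move=> aeP.
have : forall s : seq I, {ae lebesgue_measure, forall t, forall i, i \in s -> P i t}.
  elim=> [|i s IH].
    by exists set0; split => //; move=> t /= [].
  have := ae_conj _ _ (aeP i) IH; apply: ae_mono => t [Pi Ps] j.
  by rewrite inE => /predU1P[->//|/Ps].
by move=> /(_ (enum I)); apply: ae_mono => t H i; apply: H; rewrite mem_enum.
Qed.

End ae_lebesgue.

(** At the supremum of the points where [P] holds, the step hypothesis carries [P] from a point just
    before it to one just after it, unless the supremum is [b]. *)
Lemma continuous_induction (R : realType) (a b : R) (P : R -> Prop) :
  a <= b -> P a ->
  (forall c, a <= c <= b -> exists2 d, 0 < d &
     forall u v, a <= u -> v <= b -> u <= c <= v ->
       c - d < u -> v < c + d -> P u -> P v) ->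
  P b.
Proof.
move=> ab Pa step; pose S := [set t | a <= t <= b /\ P t].
have Sa : S a by split; rewrite ?lexx.
have hS : has_sup S.
  by split; [exists a | exists b => t [/andP[]]].
set s := sup S.
have sa : a <= s by apply: ub_le_sup => //; exact: hS.2.
have sb : s <= b by apply: ge_sup => [|t [/andP[]]]//; exists a.
have [|d d0 stepd] := step s; first by rewrite sa.
have [u [/andP[au ub] Pu] su] := sup_adherent d0 hS.
have us : u <= s by apply: ub_le_sup; [exact: hS.2|split => //; rewrite au].
pose v := Num.min b (s + d / 2).
have Pv : P v.
  apply: (stepd u) => //.
  - by rewrite ge_min lexx.
  - by rewrite us le_min sb/= lerDl; lra.
  - by rewrite gt_min orbC; apply/orP; left; lra.
have Sv : S v.
  split => //; rewrite ge_min lexx/= andbT le_min ab/=; lra.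
have : v <= s by apply: ub_le_sup => //; exact: hS.2.
rewrite ge_min => /orP[bs|]; last by lra.
by have -> : b = v by rewrite /v min_l//; lra.
Qed.

Definition chain (R : realType) (Q : R -> R -> Prop) (a b : R) :=
  exists (n : nat) (p : nat -> R),
    [/\ p 0%N = a, p n = b, {homo p : i j / (i <= j)%N >-> i <= j} &
      forall i, (i < n)%N -> Q (p i) (p i.+1)].

(** Cousin's lemma on partitions finer than a gauge; the tag [c] of each interval is hidden in [Q].
    It is continuous induction on the right endpoint. *)
Lemma cousin (R : realType) (a b : R) (Q : R -> R -> Prop) : a <= b ->
  (forall c, a <= c <= b -> exists2 d, 0 < d &
     forall u v, a <= u -> v <= b -> u <= c <= v ->
       c - d < u -> v < c + d -> Q u v) ->
  chain R Q a b.
Proof.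
move=> ab step; pose P t := chain R Q a t.
apply: (@continuous_induction _ a b P ab).
  by exists 0%N, (fun=> a); split.
move=> c /step[d d0 stepd]; exists d => // u v au vb ucv cu vc [n [p [pa pu np Qp]]].
have uv : u <= v by case/andP: ucv; exact: le_trans.
exists n.+1, (fun i => if (i <= n)%N then p i else v); split => //.
- by rewrite ltnn.
- move=> i j ij; have [jn|nj] := leqP j n.
    by rewrite (leq_trans ij jn) np.
  by case: ifPn => // i_n; rewrite (le_trans (np _ _ i_n))// pu.
- move=> i; rewrite ltnS => i_n; rewrite i_n; have [i1n|] := leqP i.+1 n.
    exact: Qp.
  move=> ni; have -> : i = n by apply/eqP; rewrite eqn_leq i_n.
  by rewrite pu; exact: stepd.
Qed.

(** The intervals straddle [t] because those of a Cousin partition contain their tag. *)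
Definition dini_le (R : realType) (F : R -> R) (c t : R) :=
  forall e : R, 0 < e -> exists2 d : R, 0 < d &
    forall u v, u <= t <= v -> t - d < u -> v < t + d ->
      F v - F u <= (c + e) * (v - u).

(* Off a null set the increments are controlled by the Dini bound; the null set
   is covered by an open set of small measure, in which absolute continuity
   bounds the increments of a Cousin partition. *)
Lemma abs_cont_dini_le (R : realType) (F : R -> R) (a b c : R) :
  a <= b -> 0 <= c -> abs_cont a b F ->
  {ae lebesgue_measure, forall t, a < t < b -> dini_le R F c t} ->
  F b - F a <= c * (b - a).
Proof.
move=> ab c0 acF [E [mE E0 subE]]; apply/ler_addgt0Pr => eta eta0.
pose e := eta / 2 / (b - a + 1); have ba1 : 0 < b - a + 1 by lra.
have e0 : 0 < e by rewrite !divr_gt0.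
have eta20 : 0 < eta / 2 by rewrite divr_gt0.
have [d d0 acFd] := acF _ eta20.
(* The Dini bound is assumed only in the open interval, so the endpoints join the null set. *)
pose A := E `|` [set a; b].
have mA : measurable A by do 2?apply: measurableU.
have A0 : lebesgue_measure A = 0%E.
  rewrite measureU0//; first exact: measurableU.
  by apply: countable_lebesgue_measure0; apply: finite_set_countable.
have [|U [oU AU UA]] := lebesgue_regularity_outer mA _ d0.
  by rewrite [X in (X < _)%E]A0.
have mU : measurable U by exact: measurable_realfun.open_measurable.
have Ud : (lebesgue_measure U < d%:E)%E.
  have -> : U = (U `\` A) `|` A by rewrite setUC setDUK.
  rewrite measureU//; last by rewrite setDKI.
    by rewrite [X in (_ + X)%E]A0 adde0.
  exact: measurableD.
pose good u v := F v - F u <= (c + e) * (v - u).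
have [n [p [pa pb pnd Qp]]] : chain R (fun u v => good u v \/ `]u, v[ `<=` U) a b.
  apply: cousin => // t /andP[at_ tb].
  have [tU|tU] := pselect (U t).
    have /nbhs_ballP[/= r r0 rU] := open_nbhs_nbhs (conj oU tU).
    exists r => // u v _ _ _ ut vt; right => s /=; rewrite in_itv/= => /andP[us sv].
    by apply: rU; rewrite /ball/= ltr_norml; lra.
  have Dt : dini_le R F c t.
    apply: contrapT => nD; apply: tU; apply: AU.
    have [ta|ta] := eqVneq t a; first by right; left.
    have [tb'|tb'] := eqVneq t b; first by right; right.
    left; apply: subE => /=; apply: contra_not nD; apply.
    by rewrite !lt_neqAle at_ tb tb' eq_sym ta.
  have [r r0 rP] := Dt _ e0.
  by exists r => // u v _ _ utv ut vt; left; exact: rP.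
pose u (i : 'I_n) := p i.
(* Good intervals collapse to a point, so the remaining ones lie in [U] and have total length less
   than [d]. *)
pose v (i : 'I_n) := if good (p i) (p i.+1) then p i else p i.+1.
have pS i : p i <= p i.+1 by apply: pnd.
have uv i : u i <= v i by rewrite /v; case: ifP => _; [exact: lexx | exact: pS].
have vS (i : 'I_n) : v i <= p i.+1 by rewrite /v; case: ifP => _; [exact: pS | exact: lexx].
have uvab i : [/\ a <= u i, u i <= v i & v i <= b].
  split => //; first by rewrite -pa pnd.
  by rewrite (le_trans (vS _))// -pb pnd.
have tuv : trivIset setT (fun i => `]u i, v i[%classic).
  move=> i j _ _ [x [xi xj]].
  move: xi xj; rewrite /= !in_itv/= => /andP[uix xvi] /andP[ujx xvj].
  apply/val_inj; case: (ltngtP i j) => // ij.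
    have := lt_trans ujx xvi; rewrite ltNge => /negP; case.
    by rewrite (le_trans (vS _))// /u pnd.
  have := lt_trans uix xvj; rewrite ltNge => /negP; case.
  by rewrite (le_trans (vS _))// /u pnd.
have sumd : \sum_i (v i - u i) < d.
  rewrite -lte_fin; apply: le_lt_trans Ud.
  rewrite -sumEFin.
  have -> : (\sum_i (v i - u i)%:E =
      \sum_i lebesgue_measure (`]u i, v i[%classic : set R))%E.
    apply: eq_bigr => i _; rewrite lebesgue_measure_itv/= lte_fin.
    have := uv i; rewrite le_eqVlt => /predU1P[<-|->//].
    by rewrite ltxx subrr.
  rewrite -(@measure_bigsetU_ord _ _ _ _ _ xpredT)//.
  apply: le_measure; rewrite ?inE//; first exact: bigsetU_measurable.
  apply: (big_ind (fun B => B `<=` U)) => [//|B C BU CU|i _ x].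
    by rewrite subUset.
  rewrite /u /v.
  case: ifPn => ng; first by rewrite set_itv_ge ?bnd_simp ?ltxx.
  by case: (Qp i) => // [g|]; [rewrite g in ng | exact].
have := acFd _ _ _ uvab tuv sumd => sumF.
rewrite -{1}pb -{1}pa -(telescope_sumr (fun i => F (p i)) (leq0n n)) big_mkord.
apply: (@le_trans _ _ (\sum_(i < n) ((c + e) * (p i.+1 - p i) + `|F (v i) - F (u i)|))).
  apply: ler_sum => i _; rewrite /v; case: ifPn => [g|ng].
    by rewrite /u subrr normr0 addr0.
  apply: (le_trans (ler_norm _)); rewrite lerDr mulr_ge0//; first lra.
  by rewrite subr_ge0.
rewrite big_split/= -mulr_sumr -(big_mkord xpredT (fun i => p i.+1 - p i)).
rewrite (telescope_sumr p (leq0n n)) pb pa.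
have : e * (b - a) <= eta / 2.
  by rewrite /e mulrAC ler_pdivrMr// ler_pM2l//; lra.
by lra.
Qed.

Lemma derivable_approx (R : realType) (f : R -> R) (t : R) :
  derivable f t 1 -> forall e : R, 0 < e -> exists2 d : R, 0 < d &
    forall s, `|s - t| < d ->
      `|f s - f t - derive1 f t * (s - t)| <= e * `|s - t|.
Proof.
move=> df e e0.
have /cvgrPdist_le/(_ _ e0) : h^-1 *: (f (h *: 1 + t) - f t) @[h --> 0^'] --> derive1 f t.
  by rewrite derive1E; exact: df.
move=> /nbhs_ballP[/= d d0 dP]; exists d => // s st.
have [->|nst] := eqVneq s t; first by rewrite !subrr mulr0 subrr normr0 mulr0.
have st0 : s - t != 0 by rewrite subr_eq0.
have := dP (s - t); rewrite /ball/= sub0r normrN => /(_ st st0).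
rewrite [(s - t)%R *: 1]mulr1 subrK => H.
rewrite -(ler_pdivrMr _ _ (_ : 0 < `|s - t|)) ?normr_gt0// -normfV -normrM.
rewrite distrC in H; apply: le_trans H; rewrite le_eqVlt; apply/orP; left; apply/eqP.
congr (`| _ |); rewrite /GRing.scale/=; field.
by rewrite st0.
Qed.

Lemma derivable_dini_le (R : realType) (F : R -> R) (c t : R) :
  derivable F t 1 -> derive1 F t <= c -> dini_le R F c t.
Proof.
move=> dF Fc e e0; have [d d0 dP] := derivable_approx _ _ _ dF _ e0.
exists d => // u v /andP[ut tv] du dv.
have /dP Hu : `|u - t| < d by rewrite ltr_norml; lra.
have /dP Hv : `|v - t| < d by rewrite ltr_norml; lra.
move: Hu Hv; rewrite (ler0_norm (_ : u - t <= 0)) ?subr_le0//.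
rewrite (ger0_norm (_ : 0 <= v - t)) ?subr_ge0// !ler_norml => /andP[Hu1 Hu2] /andP[Hv1 Hv2].
have : derive1 F t * (v - u) <= c * (v - u) by rewrite ler_wpM2r//; lra.
nra.
Qed.

(* A zero with a nonzero derivative is isolated, so there are countably many. *)
Lemma ae_zero_derive (R : realType) (f : R -> R) :
  {ae lebesgue_measure, forall t, f t = 0 -> derivable f t 1 -> derive1 f t = 0}.
Proof.
pose Z n := [set t | f t = 0 /\ forall s, f s = 0 -> `|s - t| < n.+1%:R^-1 -> s = t].
have cZ : countable (\bigcup_n Z n).
  apply: bigcup_countable => // n _; apply/countable_injP.
  (* Two points of [Z n] in the same cell of the grid of step 1/(n+1) are closer than 1/(n+1), hence
     equal. *)
  exists (fun t => pickle (Num.floor (t * n.+1%:R))) => s t.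
  rewrite !inE => -[fs _] [ft tP] /(pcan_inj pickleK) st; apply: tP => //.
  have n0 : (0 : R) < n.+1%:R by rewrite ltr0n.
  rewrite -(ltr_pM2r n0) mulVf ?gt_eqF// -(ger0_norm (ltW n0)) -normrM mulrBl.
  have := floor_itv (s * n.+1%:R); have := floor_itv (t * n.+1%:R).
  rewrite st; move=> /andP[t1 t2] /andP[s1 s2]; rewrite intrD in t2 s2.
  by rewrite ltr_norml; apply/andP; split; lra.
exists (\bigcup_n Z n); split.
- exact: countable_measurable.
- exact: countable_lebesgue_measure0.
- move=> t /= nt.
  have [ft [dft fn0]] : f t = 0 /\ derivable f t 1 /\ derive1 f t != 0.
    apply: contrapT => H; apply: nt => ft dft; apply: contrapT => f't; apply: H.
    by split => //; split => //; apply/eqP.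
  have e0 : 0 < `|derive1 f t| / 2 by rewrite divr_gt0// normr_gt0.
  have [d d0 dP] := derivable_approx _ _ _ dft _ e0.
  pose n := Num.truncn d^-1.
  exists n => //; split => // s fs st; apply: contrapT => /eqP nst.
  have sd : `|s - t| < d.
    apply: lt_le_trans st _; rewrite invf_ple ?posrE// ?ltr0n//.
    by apply/ltW; exact: truncnS_gt.
  have := dP _ sd; rewrite fs ft subrr sub0r normrN normrM ler_pM2r ?normr_gt0 ?subr_eq0//.
  lra.
Qed.

Definition lip (R : realType) (K : R) (f : R -> R) :=
  forall s t, `|f s - f t| <= K * `|s - t|.

(** Needed beside [lip] because squares and products of Lipschitz functions are Lipschitz only on
    bounded intervals. *)
Definition lip_in (R : realType) (a b K : R) (f : R -> R) :=
  forall s t, a <= s -> s <= t -> t <= b -> `|f t - f s| <= K * (t - s).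

Lemma lip_in_abs_cont (R : realType) (a b K : R) (f : R -> R) :
  lip_in R a b K f -> abs_cont a b f.
Proof.
move=> Lf e e0; have K0 : 0 < `|K| + 1 by rewrite ltr_wpDl.
exists (e / (`|K| + 1)); first by rewrite divr_gt0.
move=> n u v uv _; rewrite ltr_pdivlMr// => H; apply: le_lt_trans H.
rewrite mulr_suml; apply: ler_sum => i _; have [au uvi vb] := uv i.
apply: (le_trans (Lf _ _ au uvi vb)); rewrite mulrC ler_wpM2l ?subr_ge0//.
by rewrite (le_trans (ler_norm _))// lerDl.
Qed.

Lemma lip_lip_in (R : realType) (a b K : R) (f : R -> R) :
  lip R K f -> lip_in R a b K f.
Proof. by move=> Lf s t _ st _; rewrite -[t - s]ger0_norm ?subr_ge0. Qed.

Lemma lip_in_dini_le (R : realType) (F : R -> R) (a b c K : R) :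
  a <= b -> 0 <= c -> lip_in R a b K F ->
  {ae lebesgue_measure, forall t, a < t < b -> dini_le R F c t} ->
  F b - F a <= c * (b - a).
Proof. by move=> ab c0 /lip_in_abs_cont; exact: abs_cont_dini_le. Qed.

(** One-sided information suffices since the derivative exists. The future of [t] is used for the
    sign of a velocity, the past, in [derive_ge_left], for the rate of change of a force. *)
Lemma derive_le_right (R : realType) (f : R -> R) (t c d : R) : 0 < d ->
  derivable f t 1 ->
  (forall s, t < s -> s < t + d -> f s - f t <= c * (s - t)) -> derive1 f t <= c.
Proof.
move=> d0 df H; apply/ler_addgt0Pr => e e0.
have [r r0 rP] := derivable_approx _ _ _ df _ e0.
pose h := Num.min r d / 2.
have h0 : 0 < h by rewrite divr_gt0// lt_min r0.
have hr : h < r.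
  have : h <= r / 2 by rewrite /h ler_pM2r ?invr_gt0// ge_min lexx.
  lra.
have hd : h < d.
  have : h <= d / 2 by rewrite /h ler_pM2r ?invr_gt0// ge_min lexx orbT.
  lra.
have := H (t + h); rewrite ltrDl ltrD2l => /(_ h0 hd).
have := rP (t + h); rewrite addrAC subrr add0r gtr0_norm// => /(_ hr).
rewrite ler_norml => /andP[H1 H2] H3.
rewrite -(ler_pM2r h0); nra.
Qed.

Lemma derive_ge_left (R : realType) (f : R -> R) (t c d : R) : 0 < d ->
  derivable f t 1 ->
  (forall s, t - d < s -> s < t -> f s - f t <= c * (s - t)) -> c <= derive1 f t.
Proof.
move=> d0 df H; rewrite -subr_ge0; apply/ler_addgt0Pr => e e0.
have [r r0 rP] := derivable_approx _ _ _ df _ e0.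
pose h := Num.min r d / 2.
have h0 : 0 < h by rewrite divr_gt0// lt_min r0.
have hr : h < r.
  have : h <= r / 2 by rewrite /h ler_pM2r ?invr_gt0// ge_min lexx.
  lra.
have hd : h < d.
  have : h <= d / 2 by rewrite /h ler_pM2r ?invr_gt0// ge_min lexx orbT.
  lra.
have := H (t - h); rewrite ltrD2l ltrN2 gtrBl => /(_ hd h0).
have := rP (t - h); rewrite addrAC subrr add0r normrN gtr0_norm// => /(_ hr).
rewrite ler_norml => /andP[H1 H2] H3.
rewrite -(ler_pM2r h0); nra.
Qed.

Lemma lip_derive_le (R : realType) (f : R -> R) (K t : R) :
  lip R K f -> derivable f t 1 -> `|derive1 f t| <= K.
Proof.
move=> Lf df; rewrite ler_norml; apply/andP; split.
  apply: (derive_ge_left _ _ _ _ 1) => // s _ st.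
  have := Lf s t; rewrite ler_norml (ltr0_norm (_ : s - t < 0)) ?subr_lt0//; lra.
apply: (derive_le_right _ _ _ _ 1) => // s st _.
by have := Lf s t; rewrite ler_norml (gtr0_norm (_ : 0 < s - t)) ?subr_gt0//; lra.
Qed.

(** * Differentiation rules for functions written pointwise *)

Section is_derive_pointwise.
Context {R : realType}.
Implicit Types (f g : R -> R) (t a b k : R).

Lemma is_derive1P f t : derivable f t 1 -> is_derive t 1 f (derive1 f t).
Proof. by rewrite derive1E; exact: derivableP. Qed.

Lemma is_derive1E f t a : is_derive t 1 f a -> derive1 f t = a.
Proof. by move=> df; rewrite derive1E derive_val. Qed.

Lemma is_derive1_derivable f t a : is_derive t 1 f a -> derivable f t 1.
Proof. by case. Qed.

Lemma is_derive1D f g t a b : is_derive t 1 f a -> is_derive t 1 g b ->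
  is_derive t 1 (fun s => f s + g s) (a + b).
Proof. by move=> df dg; exact: (is_deriveD df dg). Qed.

Lemma is_derive1B f g t a b : is_derive t 1 f a -> is_derive t 1 g b ->
  is_derive t 1 (fun s => f s - g s) (a - b).
Proof. by move=> df dg; exact: (is_deriveB df dg). Qed.

Lemma is_derive1Z k f t a : is_derive t 1 f a ->
  is_derive t 1 (fun s => k * f s) (k * a).
Proof. by move=> df; exact: (is_deriveZ k df). Qed.

Lemma is_derive1M f g t a b : is_derive t 1 f a -> is_derive t 1 g b ->
  is_derive t 1 (fun s => f s * g s) (f t * b + g t * a).
Proof. by move=> df dg; exact: (is_deriveM df dg). Qed.

Lemma is_derive1_cst k t : is_derive t 1 (fun=> k) 0.
Proof. exact: is_derive_cst. Qed.

Lemma is_derive1_sum n (f : 'I_n -> R -> R) t (a : 'I_n -> R) :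
  (forall i, is_derive t 1 (f i) (a i)) ->
  is_derive t 1 (fun s => \sum_i f i s) (\sum_i a i).
Proof.
move=> df; have := is_derive_sum df; congr (is_derive _ _ _ _).
by apply/funext => s; rewrite fct_sumE.
Qed.

End is_derive_pointwise.

(** * Lipschitz functions are integrals of their derivatives *)

(* The Stieltjes measures of [F] and [id - F] add up to the Lebesgue measure, so
   the former is absolutely continuous. *)
Lemma lip1_radon_nikodym (R : realType) (F : R -> R) (a b : R) :
  (forall s t, s <= t -> 0 <= F t - F s <= t - s) ->
  exists g : R -> R,
    lebesgue_measure.-integrable setT (EFin \o g) /\
    forall x, a <= x <= b ->
      F x - F a = \int[lebesgue_measure]_(y in `]a, x]) g y.
Proof.
move=> F1.
have Fnd : nondecreasing F by move=> s t /F1 /andP[]; rewrite subr_ge0.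
pose G t := t - F t.
have Gnd : nondecreasing G by move=> s t /F1 /andP[]; rewrite /G; lra.
have Fc : continuous F.
  move=> t; apply/cvgrPdist_le => e e0; near=> s.
  have st : `|s - t| <= e.
    by rewrite distrC; near: s; exact: cvgr_dist_le.
  have [/F1|/ltW/F1] := leP s t; move: st; rewrite !ler_norml; lra.
have Gc : continuous G by move=> t; apply: cvgB; [exact: cvg_id|exact: Fc].
pose Fm : cumulative R R := HB.pack F (isCumulative.Build R _ R F Fnd (right_continuousW Fc)).
pose Gm : cumulative R R := HB.pack G (isCumulative.Build R _ R G Gnd (right_continuousW Gc)).
pose nF := lebesgue_stieltjes_measure Fm.
pose nG := lebesgue_stieltjes_measure Gm.
have oc (H : cumulative R R) (s t : R) : s <= t ->
    lebesgue_stieltjes_measure H `]s, t]%classic = (H t - H s)%:E.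
  move=> st; rewrite /lebesgue_stieltjes_measure/= /measure_extension.
  by rewrite measurable_mu_extE/=; [rewrite wlength_itv_bnd|exact: is_ocitv].
have addE A : measure_add nF nG A = (nF A + nG A)%E by exact: measure_addE.
have add A : measurable A -> lebesgue_measure A = measure_add nF nG A.
  apply: lebesgue_measure_unique => X /ocitvP[->|[[s t]/= st ->]].
    by rewrite !measure0.
  transitivity (nF `]s, t]%classic + nG `]s, t]%classic)%E; last first.
    by rewrite -addE.
  rewrite lebesgue_measure_itv/= lte_fin st.
  by rewrite /nF /nG !oc ?ltW//= -EFinD; congr EFin; rewrite /G; ring.
(* Restricting the Stieltjes measure of [F] to a bounded interval makes it finite, as Radon-Nikodym
   is applied to a finite measure. *)
pose D := (`]a, b]%classic : set (measurableTypeR R)).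
have mD : measurable D by exact: measurable_itv.
have Dfin : (nF D < +oo)%E.
  have [ab|ba] := leP a b; first by rewrite /nF/D oc// ltry.
  have D0 : D = set0 by apply/seteqP; split => // t; rewrite /D/= in_itv/= => /andP[]; lra.
  by rewrite D0 [X in (X < _)%E](_ : _ = 0%E)//; exact: measure0.
pose nu : {finite_measure set (measurableTypeR R) -> \bar R} := mfrestr mD Dfin.
have dom : nu `<< (@lebesgue_measure R).
  apply/null_content_dominatesP => A mA A0.
  have : (nu A <= 0)%E.
    have <- : (nF A + nG A = 0)%E.
      exact: etrans (esym (addE A)) (etrans (esym (add A mA)) A0).
    apply: (@le_trans _ _ (nF A)).
      by apply: le_measure; rewrite ?inE//; exact: measurableI.
    by rewrite leeDl//; exact: measure_ge0.
  by move=> nA; apply/eqP; rewrite eq_le nA/=.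
have [g [g0 gfin gint gE]] := radon_nikodym_sigma_finite dom.
exists (fine \o g).
have fineg : EFin \o (fine \o g) = g.
  by apply/funext => t /=; rewrite fineK.
split; first by rewrite fineg.
move=> x /andP[ax xb].
have := gE _ (measurable_itv `]a, x]).
rewrite /nu/= /mfrestr /mrestr setIidl; last first.
  by apply: subset_itvl; rewrite bnd_simp.
rewrite oc// => E; rewrite -[LHS]/(fine (F x - F a)%:E).
rewrite [X in fine X]E /Rintegral.
by congr fine; rewrite -{1}fineg.
Unshelve. all: by end_near. Qed.

(** Rademacher's theorem on the line and the fundamental theorem of calculus. An affine change
    reduces to [lip1_radon_nikodym], and Lebesgue differentiation identifies the density with the
    derivative. *)
Lemma lip_density (R : realType) (f : R -> R) (K a b : R) :
  a < b -> lip R K f ->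
  exists h : R -> R, [/\ lebesgue_measure.-integrable `[a, b] (EFin \o h),
    {ae lebesgue_measure, forall t, a < t < b ->
       derivable f t 1 /\ derive1 f t = h t} &
    f b - f a = \int[lebesgue_measure]_(y in `[a, b]) h y].
Proof.
move=> ab Lf; pose C := `|K| + 1.
have C0 : 0 < C by rewrite ltr_wpDl.
have LfC s t : s <= t -> `|f t - f s| <= C * (t - s).
  move=> st; apply: (le_trans (Lf t s)).
  rewrite ger0_norm ?subr_ge0// ler_wpM2r ?subr_ge0//.
  by rewrite (le_trans (ler_norm _))// lerDl.
(* The increments of [f / C] are at most those of the identity in absolute value, so those of this
   average lie between 0 and those of the identity. *)
pose F t := (f t / C + t) / 2.
have fE t : f t = C * (2 * F t - t) by rewrite /F; field; rewrite gt_eqF.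
have F1 s t : s <= t -> 0 <= F t - F s <= t - s.
  move=> st; have := LfC _ _ st.
  have -> : f t - f s = C * (2 * (F t - F s) - (t - s)).
    by rewrite !fE; ring.
  rewrite normrM (gtr0_norm C0) ler_pM2l// ler_norml => /andP[? ?].
  by apply/andP; split; lra.
have [g [gint gE]] := lip1_radon_nikodym _ _ a b F1.
have gab : lebesgue_measure.-integrable `[a, b] (EFin \o g).
  exact: integrableS gint.
pose h t := C * (2 * g t - 1).
exists h; split.
- have -> : EFin \o h = (fun t => (2 * C)%:E * (g t)%:E - C%:E)%E.
    by apply/funext => t /=; rewrite -EFinM -EFinB; congr EFin; rewrite /h; ring.
  apply: integrableB => //; first exact: integrableZl.
  apply: continuous_compact_integrable; first exact: segment_compact.
  by apply: continuous_subspaceT => ?; exact: cvg_cst.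
- have gy y : lebesgue_measure.-integrable [set` Interval (BRight a) (BRight y)] (EFin \o g).
    exact: integrableS gint.
  have := FTC1 gy.
  have [locg FTCg] : locally_integrable setT g /\ True.
    by split => //; apply: open_integrable_locally => //; exact: openT.
  move=> /(_ locg); apply: ae_mono => t H /andP[at_ tb].
  have [] := H at_.
  set I := (fun x => _) => dI I't.
  have nF : \near t, F t = F a + I t.
    near=> s; have := gE s; rewrite /I => <-; first by rewrite addrC subrK.
    have : s \in `]a, b[ by near: s; apply: near_in_itvoo; rewrite in_itv/= at_.
    by rewrite in_itv/= => /andP[/ltW-> /ltW->].
  have dI1 : is_derive t 1 I (g t) by rewrite -I't; exact: is_derive1P.
  have : is_derive t 1 f (h t); last first.
    by move=> df; split; [exact: is_derive1_derivable df|exact: is_derive1E].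
  rewrite [f](_ : _ = (fun s => C * (2 * F s - s))); last by apply/funext.
  apply: is_derive1Z; apply: is_derive1B; apply: is_derive1Z.
  apply: (near_eq_is_derive _ (f := fun s => F a + I s)).
    by near=> s; apply/esym; near: s.
  by rewrite -[g t]add0r; apply: is_derive1D => //; exact: is_derive1_cst.
- have gb := gE b; rewrite (ltW ab) lexx in gb.
  have ig : lebesgue_measure.-integrable `]a, b] (EFin \o g) by exact: integrableS gint.
  rewrite Rintegral_itv_obnd_cbnd// in gb.
  have i1 : lebesgue_measure.-integrable `[a, b] (EFin \o (fun=> 1 : R)).
    apply: continuous_compact_integrable; first exact: segment_compact.
    by apply: continuous_subspaceT => ?; exact: cvg_cst.
  have i2 : lebesgue_measure.-integrable `[a, b] (EFin \o (fun t => 2 * g t)).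
    rewrite (_ : _ \o _ = (fun t => 2%:E * (g t)%:E)%E); first exact: integrableZl.
    by apply/funext.
  rewrite RintegralZl//; last first.
    rewrite (_ : _ \o _ = (fun t => (2 * g t)%:E - 1%:E)%E); first exact: integrableB.
    by apply/funext.
  rewrite RintegralB// RintegralZl// -gb// Rintegral_cst//.
  have L : lebesgue_measure (`[a, b]%classic : set R) = (b - a)%:E.
    by rewrite lebesgue_measure_itv/= lte_fin ab.
  by rewrite [X in fine X]L/= !fE; ring.
Unshelve. all: by end_near. Qed.

Import HBNNSimple.

(* [F] is not assumed measurable because the derivative in [W12norm] takes
   arbitrary values on a null set. *)
Lemma ge0_integral_le_ae d (T : measurableType d) (R : realType)
    (mu : {measure set T -> \bar R}) (D : set T) (F : T -> \bar R)
    (rho : T -> R) :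
  measurable D -> (forall t, (0 <= F t)%E) ->
  mu.-integrable D (EFin \o rho) ->
  {ae mu, forall t, D t -> (F t <= (rho t)%:E)%E} ->
  (\int[mu]_(t in D) F t <= (\int[mu]_(t in D) rho t)%:E)%E.
Proof.
move=> mD F0 irho Frho.
have mrho : measurable_fun D (EFin \o rho) by exact: measurable_int irho.
(* [rho] dominates only almost everywhere and may be negative on a null set; its positive part has
   the same integral. *)
pose rp t := (Num.max (rho t) 0)%:E.
have mrp : measurable_fun D rp.
  by apply/measurable_EFinP/measurable_maxr => //; exact/measurable_EFinP.
have -> : ((\int[mu]_(t in D) rho t)%:E = \int[mu]_(t in D) rp t)%E.
  rewrite /Rintegral fineK; last exact: integrable_fin_num.
  apply: ae_eq_integral => //.
  move: Frho; apply: filterS => t H Dt /=; rewrite /rp max_l//.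
  by rewrite -lee_fin; exact: le_trans (F0 t) (H Dt).
(* The integral of [F] is a supremum over simple functions below [F]; these are measurable, and
   monotonicity is applied to them. *)
rewrite ge0_integralE//; apply: ge_ereal_sup => _ [h /= hF <-].
rewrite -integralT_nnsfun [leRHS]integral_mkcond.
apply: ae_ge0_le_integral => //.
- by move=> t _; rewrite lee_fin; exact: fun_ge0.
- exact/measurable_EFinP.
- by move=> t _; rewrite /patch; case: ifP => // _; rewrite /rp lee_fin le_max lexx orbT.
- by apply/(measurable_restrictT _ _).1.
- move: Frho; apply: filterS => t H _ /=.
  have := hF t; rewrite /patch; case: ifPn => //; rewrite inE => Dt hFt.
  by rewrite (le_trans hFt)// (le_trans (H Dt))// /rp lee_fin le_max lexx.
Qed.

(** * The chain and the friction law *)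

Section Chain.
Context {R : realType} {N : nat}.
Implicit Types (d w x u : 'I_N -> R) (j : 'I_N.-1) (i l : 'I_N).

(* In terms of the difference matrix D of the chain, [gap d] is D d, [incid] is
   the transpose of D, and [lap d] is D^T D d. *)
Definition gap d j : R := d (ord_next j) - d (ord_this j).

Definition incid i j : R := (i == ord_next j)%:R - (i == ord_this j)%:R.

Definition lap d i : R := \sum_j gap d j * incid i j.

Lemma incid_dot w j : \sum_i w i * incid i j = gap w j.
Proof.
rewrite /incid; under eq_bigr do rewrite mulrBr.
rewrite sumrB /gap; congr (_ - _).
  rewrite (bigD1 (ord_next j))//= eqxx mulr1 big1 ?addr0// => i /negbTE ->.
  by rewrite mulr0.
rewrite (bigD1 (ord_this j))//= eqxx mulr1 big1 ?addr0// => i /negbTE ->.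
by rewrite mulr0.
Qed.

(** Summation by parts along the chain. *)
Lemma incid_dot_sum w (g : 'I_N.-1 -> R) :
  \sum_i w i * (\sum_j g j * incid i j) = \sum_j g j * gap w j.
Proof.
under eq_bigr do rewrite mulr_sumr.
rewrite exchange_big/=; apply: eq_bigr => j _.
by rewrite -incid_dot mulr_sumr; apply: eq_bigr => i _; rewrite mulrCA.
Qed.

Lemma lap_dot w d : \sum_i w i * lap d i = \sum_j gap d j * gap w j.
Proof. exact: incid_dot_sum. Qed.

Lemma lap_dotxx d : \sum_i d i * lap d i = \sum_j gap d j ^+ 2.
Proof. by rewrite lap_dot; apply: eq_bigr => j _; rewrite expr2. Qed.

Lemma gap_cst (c : R) j : gap (fun=> c) j = 0.
Proof. by rewrite /gap subrr. Qed.

Lemma gapB d w j : gap (fun i => d i - w i) j = gap d j - gap w j.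
Proof. by rewrite /gap; ring. Qed.

Lemma lapB d w i : lap (fun i => d i - w i) i = lap d i - lap w i.
Proof.
by rewrite /lap -sumrB; apply: eq_bigr => j _; rewrite gapB mulrBl.
Qed.

Lemma ord_this_next_neq j : (ord_this j == ord_next j) = false.
Proof. by apply/eqP => /(congr1 val)/= /eqP; rewrite ltn_eqF. Qed.

Lemma lap_term_ge0 d i j : (forall l, d l <= d i) -> 0 <= gap d j * incid i j.
Proof.
move=> dmax; rewrite /gap /incid.
have [ij|_] := eqVneq i (ord_next j).
  rewrite ij in dmax *; rewrite eq_sym ord_this_next_neq subr0 mulr1.
  by rewrite subr_ge0.
have [ij|_] := eqVneq i (ord_this j); last by rewrite subrr mulr0.
rewrite ij in dmax *.
by rewrite sub0r mulrN1 oppr_ge0 subr_le0.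
Qed.

Lemma lap_max_ge0 d i : (forall l, d l <= d i) -> 0 <= lap d i.
Proof. by move=> dmax; apply: sumr_ge0 => j _; exact: lap_term_ge0. Qed.

(** Connectedness of the chain: the index is lowered link by link. *)
Lemma ord_chain_ind (S : pred 'I_N) :
  (forall j, S (ord_next j) = S (ord_this j)) -> forall i l, S i = S l.
Proof.
move=> SS; suff H : forall m i l, (i <= m)%N -> (l <= m)%N -> S i = S l.
  by move=> i l; apply: (H N); exact/ltnW/ltn_ord.
elim=> [|m IH] i l.
  by rewrite !leqn0 => /eqP i0 /eqP l0; congr S; apply/val_inj; rewrite /= i0.
have pm i' : (i' <= m.+1)%N -> exists2 i'' : 'I_N, (i'' <= m)%N & S i' = S i''.
  rewrite leq_eqVlt => /predU1P[i'm|]; last by exists i'.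
  have mN : (m < N.-1)%N by rewrite ltn_predRL -i'm.
  exists (ord_this (Ordinal mN)) => //.
  by rewrite -SS; congr S; apply/val_inj; rewrite /= i'm.
by move=> /pm[i' im ->] /pm[l' lm ->]; exact: IH.
Qed.

(** Discrete strong maximum principle: at a maximum all terms of [lap d] are nonnegative, so they
    all vanish, the neighbours are maxima too, and the value spreads along the chain. *)
Lemma lap_max_eq0 d :
  (forall i, (forall l, d l <= d i) -> lap d i <= 0) -> forall i l, d i = d l.
Proof.
move=> lapd i0 l0; pose m := [arg max_(i > i0) d i]%O.
have dm l : d l <= d m by rewrite /m; case: arg_maxP => // i _; apply.
suff dE i : d i == d m by rewrite (eqP (dE i0)) (eqP (dE l0)).
have maxE i' : d i' = d m -> forall j, gap d j * incid i' j = 0.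
  move=> i'm j.
  have i'max l : d l <= d i' by rewrite i'm.
  have ge j' : true -> 0 <= gap d j' * incid i' j' by move=> _; exact: lap_term_ge0.
  have : lap d i' == 0 by rewrite eq_le lapd//= lap_max_ge0.
  by rewrite /lap psumr_eq0// => /allP/(_ j); rewrite mem_index_enum => /(_ isT)/eqP.
rewrite (ord_chain_ind (fun i => d i == d m) _ i m)// => j.
apply/idP/idP => /eqP dj; have := maxE _ dj j.
  rewrite /incid eqxx eq_sym ord_this_next_neq subr0 mulr1 /gap.
  by move/eqP; rewrite subr_eq0 => /eqP <-; rewrite dj.
rewrite /incid eqxx ord_this_next_neq sub0r mulrN1 /gap.
by move/eqP; rewrite oppr_eq0 subr_eq0 => /eqP ->; rewrite dj.
Qed.

Lemma lap_bound (v : 'I_N -> R) (e : R) i : 0 <= e -> (forall l, `|v l| <= e) ->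
  `|lap v i| <= N%:R * (2 * e).
Proof.
move=> e0 ve; apply: (le_trans (ler_norm_sum _ _ _)).
apply: (@le_trans _ _ (\sum_(j < N.-1) 2 * e)).
  apply: ler_sum => j _; rewrite normrM -[leRHS]mulr1 ler_pM//.
    have := ve (ord_next j); have := ve (ord_this j); rewrite /gap !ler_norml; lra.
  by rewrite /incid; case: eqP => _; case: eqP => _; rewrite ?subrr ?subr0 ?sub0r ?normrN ?normr0 ?normr1.
rewrite sumr_const card_ord -[X in X <= _]mulr_natl ler_wpM2r ?ler_nat ?leq_pred//.
by rewrite mulr_ge0.
Qed.

Definition gapsum d : R := \sum_j `|gap d j|.

Lemma gapsum_ge0 d : 0 <= gapsum d.
Proof. exact: sumr_ge0. Qed.

Lemma le_gapsum d i l : `|d i - d l| <= gapsum d *+ 2.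
Proof.
(* Both bodies are joined to body 0, which costs the factor 2. *)
suff H : forall m i, nat_of_ord i = m -> forall z : 'I_N, nat_of_ord z = 0%N ->
    `|d i - d z| <= \sum_(j : 'I_N.-1 | (j < m)%N) `|gap d j|.
  have N0 : (0 < N)%N by rewrite (leq_ltn_trans _ (ltn_ord i)).
  have Hz i' : `|d i' - d (Ordinal N0)| <= gapsum d.
    apply: (le_trans (H _ i' erefl (Ordinal N0) erefl)).
    by rewrite [leRHS](bigID (fun j : 'I_N.-1 => (j < i')%N))/= lerDl sumr_ge0.
  have := Hz i; have := Hz l; rewrite mulr2n !ler_norml; lra.
elim=> [|m IH] {i l} i im z z0.
  have -> : i = z by apply/val_inj; rewrite /= im.
  by rewrite subrr normr0 sumr_ge0.
have mN : (m < N.-1)%N by rewrite ltn_predRL -im.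
pose j := Ordinal mN.
have -> : i = ord_next j by apply/val_inj; rewrite /= im.
rewrite (bigD1 j)//=; apply: (@le_trans _ _ (`|gap d j| + `|d (ord_this j) - d z|)).
  by rewrite (le_trans _ (ler_normD _ _))// /gap addrA subrK.
rewrite lerD2l; apply: (le_trans (IH (ord_this j) erefl z z0)).
rewrite le_eqVlt; apply/orP; left; apply/eqP; apply: eq_bigl => j'.
by rewrite /= ltnS -(inj_eq val_inj)/= (ltn_neqAle j') andbC.
Qed.

(** Cauchy-Schwarz against the constant vector, read off from the double sum of the squares (a p - a
    q)^2. *)
Lemma gapsum_sqr d : gapsum d ^+ 2 <= N%:R * \sum_j gap d j ^+ 2.
Proof.
have CS n (a : 'I_n -> R) : (\sum_p a p) ^+ 2 <= n%:R * \sum_p a p ^+ 2.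
  have : 0 <= \sum_p \sum_q (a p - a q) ^+ 2.
    by apply: sumr_ge0 => p _; apply: sumr_ge0 => q _; exact: sqr_ge0.
  have -> : \sum_p \sum_q (a p - a q) ^+ 2 =
      (n%:R * \sum_p a p ^+ 2 - (\sum_p a p) ^+ 2) *+ 2.
    have E p : \sum_q (a p - a q) ^+ 2 =
        n%:R * a p ^+ 2 - 2 * a p * (\sum_q a q) + \sum_q a q ^+ 2.
      have -> : n%:R * a p ^+ 2 = \sum_(q < n) a p ^+ 2.
        by rewrite sumr_const card_ord mulr_natl.
      rewrite mulr_sumr -sumrB -big_split/=; apply: eq_bigr => q _; ring.
    rewrite (eq_bigr _ (fun p _ => E p)) big_split sumrB/= -mulr_sumr -mulr_suml.
    by rewrite sumr_const card_ord -mulr_sumr mulr2n -[X in _ + X]mulr_natl; ring.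
  by rewrite mulr2n; lra.
apply: (le_trans (CS _ _)); under eq_bigr do rewrite real_normK ?num_real//.
by rewrite ler_wpM2r ?sumr_ge0 ?ler_nat ?leq_pred// => j _; exact: sqr_ge0.
Qed.

End Chain.

(** * Forces, friction and the subdifferential at a fixed time *)

Section Crawler_statics.
Context {R : realType} {N : nat} {T : R} (k : R) (G : gait N T).
Implicit Types (x : 'I_N -> R) (i : 'I_N) (t : R).

(** Minus the gradient of the energy, by [gradient_energyE], for a configuration given as a function
    of the body. *)
Definition force t x i : R :=
  - (k * \sum_j (gap x j - gL G j t) * incid i j).

(* [f] is a subgradient of the dissipation of body [i] at velocity [v]. *)
Definition friction_incl t i (v f : R) : Prop :=
  [/\ - gmum G i t <= f <= gmup G i t, 0 < v -> f = gmup G i t &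
      v < 0 -> f = - gmum G i t].

Definition nondegenerate t : Prop := forall J : {set 'I_N},
  \sum_(i in J) gmup G i t - \sum_(i in ~: J) gmum G i t != 0.

Lemma ae_nondegenerate : {ae lebesgue_measure, forall t, nondegenerate t}.
Proof. by apply: ae_forall_fin => J; exact: gmu_neq0. Qed.

Lemma forceB t x y i :
  force t x i - force t y i = - (k * lap (fun l => x l - y l) i).
Proof.
rewrite /force -opprD -mulrBr; congr (- (k * _)).
by rewrite /lap -sumrB; apply: eq_bigr => j _; rewrite gapB; ring.
Qed.

(** The springs are internal: action equals reaction. *)
Lemma force_sum0 t x : \sum_i force t x i = 0.
Proof.
rewrite /force sumrN -mulr_sumr.
have := incid_dot_sum (fun=> 1 : R) (fun j => gap x j - gL G j t).
under eq_bigr do rewrite mul1r.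
move=> ->; rewrite big1 ?mulr0 ?oppr0// => j _.
by rewrite gap_cst mulr0.
Qed.

Lemma force_shift t x c i : force t (fun l => x l + c) i = force t x i.
Proof.
rewrite /force; congr (- (_ * _)); apply: eq_bigr => j _.
by rewrite /gap; congr (_ * _); ring.
Qed.

Lemma force_periodic t x i q : force (t + q%:R * T) x i = force t x i.
Proof.
rewrite /force; congr (- (_ * _)); apply: eq_bigr => j _.
by rewrite mulr_natl; rewrite (periodicn (gL_periodic G j)).
Qed.

Lemma gmup_periodicn t i q : gmup G i (t + q%:R * T) = gmup G i t.
Proof. by rewrite mulr_natl; rewrite (periodicn (gmup_periodic G i)). Qed.

Lemma gmum_periodicn t i q : gmum G i (t + q%:R * T) = gmum G i t.
Proof. by rewrite mulr_natl; rewrite (periodicn (gmum_periodic G i)). Qed.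

Lemma friction_incl_monotone t i v w xi eta :
  friction_incl t i v xi -> friction_incl t i w eta ->
  0 <= (xi - eta) * (v - w).
Proof.
move=> [/andP[xi1 xi2] vp vn] [/andP[eta1 eta2] wp wn].
have [vw|wv|->] := ltgtP v w; last by rewrite subrr mulr0.
- suff : xi <= eta by move=> ?; rewrite mulr_le0 ?subr_le0 ?(ltW vw).
  have [v0|v0] := ltP v 0; first by rewrite vn.
  by rewrite (wp (le_lt_trans v0 vw)).
- suff : eta <= xi by move=> ?; rewrite mulr_ge0 ?subr_ge0 ?(ltW wv).
  have [w0|w0] := ltP w 0; first by rewrite wn.
  by rewrite (vp (le_lt_trans w0 wv)).
Qed.

(* If every body moved faster in the first motion, then monotonicity and
   [\sum xi = \sum eta] would give [xi = eta], with each component saturated. *)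
Lemma no_common_drift t u w xi eta : nondegenerate t ->
  (forall i, friction_incl t i (u i) (xi i)) ->
  (forall i, friction_incl t i (w i) (eta i)) ->
  \sum_i xi i = \sum_i eta i -> \sum_i xi i = 0 ->
  ~ forall i, w i < u i.
Proof.
move=> nd uxi weta xieta xi0 wu.
have le i : eta i <= xi i.
  have := friction_incl_monotone _ _ _ _ _ _ (uxi i) (weta i).
  by rewrite pmulr_lge0 ?subr_ge0// subr_gt0.
have eqxi i : xi i = eta i.
  have /psumr_eq0P : forall i, true -> 0 <= xi i - eta i by move=> *; rewrite subr_ge0.
  rewrite sumrB xieta subrr => /(_ erefl i isT)/eqP.
  by rewrite subr_eq0 => /eqP.
(* On [J] the force is [gmup]. Off [J] the second velocity is negative, so the common force is
   [- gmum]. The total force, which is 0, is thus the sum that nondegeneracy forbids to vanish. *)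
pose J := finset.finset (fun i => 0 < u i).
have /eqP := nd J; apply; rewrite -[RHS]xi0.
rewrite [RHS](bigID (fun i => i \in J))/= -sumrN; congr (_ + _).
  by apply: eq_bigr => i; rewrite finset.in_set => ui; have [_ ->] := uxi i.
apply: eq_big => i; first by rewrite finset.in_setC.
rewrite finset.in_setC finset.in_set -leNgt => ui.
by rewrite eqxi; have [_ _ ->//] := weta i; exact: lt_le_trans (wu i) ui.
Qed.

(** [no_common_drift], used in both directions, gives a component of [u - w] that is at most 0 and
    one that is at least 0, so each component is bounded by the spread. *)
Lemma drift_bound t u w xi eta : nondegenerate t ->
  (forall i, friction_incl t i (u i) (xi i)) ->
  (forall i, friction_incl t i (w i) (eta i)) ->
  \sum_i xi i = 0 -> \sum_i eta i = 0 ->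
  forall i, `|u i - w i| <= gapsum (fun l => u l - w l) *+ 2.
Proof.
move=> nd uxi weta xi0 eta0 i.
have xieta : \sum_i xi i = \sum_i eta i by rewrite xi0.
have [l1 hl1] : exists l, u l - w l <= 0.
  apply: contrapT => H; apply: (no_common_drift _ _ _ _ _ nd uxi weta xieta xi0).
  by move=> l; rewrite ltNge; apply/negP => ul; apply: H; exists l; rewrite subr_le0.
have [l2 hl2] : exists l, 0 <= u l - w l.
  apply: contrapT => H.
  apply: (no_common_drift _ _ _ _ _ nd weta uxi (esym xieta) eta0).
  by move=> l; rewrite ltNge; apply/negP => ul; apply: H; exists l; rewrite subr_ge0.
have := le_gapsum (fun l => u l - w l) i l1.
have := le_gapsum (fun l => u l - w l) i l2.
rewrite !ler_norml; lra.
Qed.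

Lemma gradient_energyE t (x : 'rV[R]_N) i :
  (- gradient (energy k G t) x) 0 i = force t (fun l => x 0 l) i.
Proof.
rewrite !mxE /force; congr (- _).
pose g h := \sum_j k / 2 * ((gap (fun l => x 0 l) j - gL G j t) + h * incid i j) ^+ 2.
have -> : 'D_(delta_mx 0 i) (energy k G t) x = derive1 g 0.
  have E h : energy k G t (h *: delta_mx 0 i + x) = g h.
    rewrite /g /energy /=; apply: eq_bigr => j _; congr (_ * _ ^+ 2).
    by rewrite !mxE /gap /incid eqxx/= ![_ == i]eq_sym; ring.
  rewrite /derive /derive1.
  have -> : (fun h => h^-1 *: (g (h + 0) - g 0)) = (fun h =>
      h^-1 *: ((energy k G t \o shift x) (h *: delta_mx 0 i) - energy k G t x)).
    apply/funext => h; congr (_ *: (_ - _)); rewrite -E ?addr0//.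
    by rewrite scale0r add0r.
  by [].
apply: is_derive1E; rewrite mulr_sumr.
apply: (is_derive1_sum _ (fun j h =>
  k / 2 * ((gap (fun l => x 0 l) j - gL G j t) + h * incid i j) ^+ 2)) => j.
set A := gap _ j - _.
have d1 : is_derive (0 : R) (1 : R) (fun h => A + h * incid i j) (incid i j).
  have := is_derive1D _ _ _ _ _ (is_derive1_cst A (0 : R))
    (is_derive1Z (incid i j) _ _ _ (is_derive_id (0 : R) 1)).
  rewrite add0r mulr1; congr is_derive; apply/funext => h.
  by rewrite mulrC.
have := is_derive1Z (k / 2) _ _ _ (is_derive1M _ _ _ _ _ d1 d1); congr is_derive.
by rewrite mul0r addr0; field.
Qed.

Lemma subdifferential_dissipation t (u xi : 'rV[R]_N) :
  (forall i, 0 <= gmup G i t) -> (forall i, 0 <= gmum G i t) ->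
  subdifferential (dissipation G t) u xi ->
  forall i, friction_incl t i (u 0 i) (xi 0 i).
Proof.
move=> mup0 mum0 sub i.
have key w : dissipation1 G i t (u 0 i) + xi 0 i * (w - u 0 i) <= dissipation1 G i t w.
  have := sub (u + (w - u 0 i) *: delta_mx 0 i).
  rewrite /dissipation /dotv (bigD1 i)//= [in X in _ + X <= _](bigD1 i)//=.
  rewrite [leRHS](bigD1 i)//= !mxE !eqxx/= mulr1.
  rewrite [X in _ + (_ + X)]big1 ?addr0; last first.
    by move=> l /negbTE li; rewrite !mxE li mulr0 addr0 subrr mulr0.
  rewrite [X in _ <= _ + X](eq_bigr (fun l => dissipation1 G l t (u 0 l))); last first.
    by move=> l /negbTE li; rewrite !mxE li mulr0 addr0.
  rewrite [u 0 i + _]addrC subrK; lra.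
have hp (v : R) : 0 <= v -> dissipation1 G i t v = gmup G i t * v.
  rewrite /dissipation1 le_eqVlt => /predU1P[<-|v0]; first by rewrite lexx !mulr0.
  by rewrite leNgt v0.
have hm (v : R) : v <= 0 -> dissipation1 G i t v = - gmum G i t * v.
  by rewrite /dissipation1 => ->.
(* Euler's relation for a positively homogeneous function: testing the subgradient at 0 and at twice
   the velocity gives equality. The tests at 1 and -1 below give the two friction bounds. *)
have k0 := key 0; have k2 := key (2 * u 0 i).
rewrite (hp 0) // mulr0 in k0.
have eqxi : dissipation1 G i t (u 0 i) = xi 0 i * u 0 i.
  apply/eqP; rewrite eq_le; apply/andP; split; first lra.
  have [u0|/ltW u0] := leP (u 0 i) 0.
    by rewrite (hm (2 * _)) in k2; [rewrite !hm// in k2 *; lra|lra].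
  by rewrite (hp (2 * _)) in k2; [rewrite !hp// in k2 *; lra|lra].
split.
- have k1 := key 1; have kN := key (-1); rewrite eqxi in k1 kN.
  by rewrite hp// in k1; rewrite hm// in kN; apply/andP; split; lra.
- move=> u0; apply: (@mulIf _ (u 0 i)); first by rewrite gt_eqF.
  by rewrite -eqxi hp// ltW.
- move=> u0; apply: (@mulIf _ (u 0 i)); first by rewrite lt_eqF.
  by rewrite -eqxi hm// ltW.
Qed.

Lemma dissipation_subdifferential t (u xi : 'rV[R]_N) :
  (forall i, friction_incl t i (u 0 i) (xi 0 i)) ->
  subdifferential (dissipation G t) u xi.
Proof.
move=> uxi v /=; rewrite /dissipation /dotv -big_split/=; apply: ler_sum => i _.
rewrite !mxE; have [/andP[lo hi] up un] := uxi i.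
have le_v : xi 0 i * v 0 i <= dissipation1 G i t (v 0 i).
  rewrite /dissipation1; case: ifPn => [v0|]; first by rewrite ler_wnM2r.
  by rewrite -ltNge => /ltW v0; rewrite ler_wpM2r.
suff : dissipation1 G i t (u 0 i) = xi 0 i * u 0 i by lra.
rewrite /dissipation1; have [u0|u0|->] := ltgtP (u 0 i) 0.
- by rewrite un.
- by rewrite up.
- by rewrite !mulr0.
Qed.

End Crawler_statics.

(** * A derivative-free form of the inclusion *)

Section Lip.
Context {R : realType}.
Implicit Types f g : R -> R.

(** The constant is positive so that one may divide by it. *)
Definition Lip f := exists2 K, 0 < K & lip R K f.

Lemma lip_Lip K f : lip R K f -> Lip f.
Proof.
move=> Lf; exists (`|K| + 1); first by rewrite ltr_wpDl.
move=> s t; apply: (le_trans (Lf s t)); rewrite ler_wpM2r//.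
by rewrite (le_trans (ler_norm _))// lerDl.
Qed.

Lemma lipschitz_Lip f : lipschitz f -> Lip f.
Proof.
move=> [M [_ HM]]; apply: (@lip_Lip (M + 1)) => s t.
have M1 : M < M + 1 by rewrite ltrDl.
exact: (HM _ M1 (s, t)).
Qed.

Lemma LipD f g : Lip f -> Lip g -> Lip (fun t => f t + g t).
Proof.
move=> [K K0 Lf] [M M0 Lg]; exists (K + M); first exact: addr_gt0.
move=> s t; rewrite opprD addrACA mulrDl.
by rewrite (le_trans (ler_normD _ _))// lerD.
Qed.

Lemma LipZ c f : Lip f -> Lip (fun t => c * f t).
Proof.
move=> [K K0 Lf]; apply: (@lip_Lip (`|c| * K)) => s t.
by rewrite -mulrBr normrM -mulrA ler_wpM2l.
Qed.

Lemma LipN f : Lip f -> Lip (fun t => - f t).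
Proof.
by move=> /(LipZ (-1)) [K K0 Lf]; exists K => // s t; have := Lf s t; rewrite !mulN1r.
Qed.

Lemma LipB f g : Lip f -> Lip g -> Lip (fun t => f t - g t).
Proof. by move=> Lf /LipN; exact: LipD. Qed.

Lemma Lip_cst c : Lip (fun=> c).
Proof. by exists 1 => // s t; rewrite subrr normr0 mul1r. Qed.

Lemma Lip_sum (I : finType) (f : I -> R -> R) : (forall i, Lip (f i)) ->
  Lip (fun t => \sum_i f i t).
Proof.
move=> Lf; have : forall r : seq I, Lip (fun t => \sum_(i <- r) f i t).
  elim=> [|i r IH].
    by have [K K0 L] := Lip_cst 0; exists K => // s t; rewrite !big_nil; exact: L.
  have [K K0 L] := LipD _ _ (Lf i) IH.
  by exists K => // s t; rewrite !big_cons; exact: L.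
exact.
Qed.

Lemma Lip_shift c f : Lip f -> Lip (fun t => f (t + c)).
Proof.
by move=> [K K0 Lf]; exists K => // s t; have := Lf (s + c) (t + c); rewrite opprD addrACA subrr addr0.
Qed.

Lemma Lip_pos_right f t : Lip f -> 0 < f t ->
  exists2 d, 0 < d & forall s, t - d < s < t + d -> 0 < f s.
Proof.
move=> [K K0 Lf] ft; exists (f t / K); first by rewrite divr_gt0.
move=> s ts; have : `|s - t| < f t / K by rewrite ltr_norml; lra.
rewrite ltr_pdivlMr// => sK; have := Lf s t; rewrite ler_norml; lra.
Qed.

Lemma Lip_uniform (I : finType) (f : I -> R -> R) : (forall i, Lip (f i)) ->
  exists2 K, 0 < K & forall i, lip R K (f i).
Proof.
move=> /(_ _)/cid2-/all_sig2[K K0 Lf]; exists (1 + \sum_i K i).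
  by rewrite ltr_pwDl// sumr_ge0// => i _; exact/ltW.
move=> i s t; apply: (le_trans (Lf i s t)); rewrite ler_wpM2r//.
by rewrite (bigD1 i)//= addrCA lerDl addr_ge0// sumr_ge0// => l _; exact/ltW.
Qed.

Lemma Lip_continuous f : Lip f -> continuous f.
Proof.
move=> [K K0 Lf] t; apply/cvgrPdist_le => e e0; near=> s.
apply: (le_trans (Lf _ _)); rewrite mulrC -ler_pdivlMr//.
by near: s; apply: cvgr_dist_le => //; rewrite divr_gt0.
Unshelve. all: by end_near. Qed.

End Lip.

Section Crawling.
Context {R : realType} {N : nat} {T : R} (k : R) (G : gait N T).
Implicit Types (X Y : 'I_N -> R -> R) (i : 'I_N) (a s t : R).

Definition forces X t i : R := force k G t (fun l => X l t) i.

(* The pointwise inclusion without derivatives: a body on which the friction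
   bound [gmup] (resp. [gmum]) is not reached cannot advance (resp. recede).
   In this form it is stable under pointwise limits and time shifts. *)
Definition crawling a X : Prop :=
  [/\ forall i, Lip (X i),
      forall i t, a <= t -> - gmum G i t <= forces X t i <= gmup G i t,
      forall i s t, a <= s -> s <= t ->
        (forall r, s <= r <= t -> forces X r i < gmup G i r) -> X i t <= X i s &
      forall i s t, a <= s -> s <= t ->
        (forall r, s <= r <= t -> - gmum G i r < forces X r i) -> X i s <= X i t].

Lemma Lip_gap X j : (forall i, Lip (X i)) -> Lip (fun t => gap (fun l => X l t) j).
Proof. by move=> LX; exact: LipB. Qed.

Lemma Lip_forces X i : (forall i, Lip (X i)) -> Lip (fun t => forces X t i).
Proof.
move=> LX; rewrite /forces /force; apply: LipN; apply: LipZ; apply: Lip_sum => j.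
have : Lip (fun t => incid i j * (gap (fun l => X l t) j - gL G j t)).
  apply: LipZ; apply: LipB; first exact: Lip_gap.
  exact/lipschitz_Lip/gL_lipschitz.
by move=> [K K0 L]; exists K => // s t; have := L s t; rewrite ![incid i j * _]mulrC.
Qed.

Lemma Lip_gmup i : Lip (gmup G i).
Proof. exact/lipschitz_Lip/gmup_lipschitz. Qed.

Lemma Lip_gmum i : Lip (gmum G i).
Proof. exact/lipschitz_Lip/gmum_lipschitz. Qed.

(** If a friction bound is not reached at [t], by continuity it is not reached just after [t]; the
    body is then monotone there, which contradicts the sign of its velocity. *)
Lemma crawling_incl a X t i : crawling a X -> a <= t -> derivable (X i) t 1 ->
  friction_incl G t i (derive1 (X i) t) (forces X t i).
Proof.
move=> [LX adm mup mum] at_ dX; have /andP[lo hi] := adm i _ at_.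
split; first by rewrite lo.
- move=> v0; apply/eqP; rewrite eq_le hi/= leNgt; apply/negP => lt_mu.
  have := Lip_pos_right (fun t => gmup G i t - forces X t i) t.
  rewrite subr_gt0 => /(_ (LipB _ _ (Lip_gmup i) (Lip_forces _ i LX)) lt_mu)[d d0 dP].
  have : derive1 (X i) t <= 0; last by lra.
  apply: (derive_le_right _ _ _ _ d) => // s ts sd; rewrite mul0r subr_le0.
  apply: mup => //; first exact: ltW.
  by move=> r /andP[tr rs]; rewrite -subr_gt0; apply: dP; lra.
- move=> v0; apply/eqP; rewrite eq_le lo andbT leNgt; apply/negP => lt_mu.
  have [||d d0 dP] := Lip_pos_right (fun t => forces X t i + gmum G i t) t.
  - exact: LipD (Lip_forces _ i LX) (Lip_gmum i).
  - by rewrite -ltrBlDr sub0r.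
  have dXN : is_derive t 1 (fun s => - X i s) (- derive1 (X i) t).
    by apply: is_deriveN; exact: is_derive1P.
  have : - derive1 (X i) t <= 0; last by lra.
  rewrite -(is_derive1E _ _ _ dXN).
  apply: (derive_le_right _ _ _ _ d) => //.
  move=> s ts sd; rewrite mul0r opprK addrC subr_le0.
  apply: mum => //; first exact: ltW.
  by move=> r /andP[tr rs]; rewrite -sub0r ltrBlDr; apply: dP; lra.
Qed.

End Crawling.

(** * Comparison of two motions *)

Lemma ae_derivable (R : realType) (f : R -> R) : Lip f ->
  {ae lebesgue_measure, forall t, derivable f t 1}.
Proof.
move=> [K _ Lf].
have : forall n : nat, {ae lebesgue_measure, forall t : R, - n.+1%:R < t < n.+1%:R -> derivable f t 1}.
  move=> n; have n0 : - n.+1%:R < n.+1%:R :> R.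
    by rewrite (@lt_trans _ _ 0) ?oppr_lt0 ?ltr0n.
  have [h [_ dfh _]] := lip_density _ _ _ _ _ n0 Lf.
  by move: dfh; apply: ae_mono => t H /H[].
move/ae_foralln; apply: ae_mono => t /(_ (Num.truncn `|t|)); apply.
by rewrite -ltr_norml truncnS_gt.
Qed.

Lemma fin_pos (R : realType) (I : finType) (P : I -> R -> Prop) :
  (forall i d d', 0 < d' -> d' <= d -> P i d -> P i d') ->
  (forall i, exists2 d, 0 < d & P i d) -> exists2 d, 0 < d & forall i, P i d.
Proof.
move=> mono /(_ _)/cid2-/all_sig2[d d0 dP].
have H : forall r : seq I, exists2 e, 0 < e & forall i, i \in r -> P i e.
  elim=> [|i r [e e0 eP]]; first by exists 1.
  exists (Num.min (d i) e); first by rewrite lt_min d0.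
  move=> l; rewrite inE => /predU1P[->|lr].
    by apply: mono (dP i); rewrite ?lt_min ?d0// ge_min lexx.
  by apply: mono (eP _ lr); rewrite ?lt_min ?d0// ge_min lexx orbT.
have [e e0 eP] := H (enum I); exists e => // i.
by apply: eP; rewrite mem_enum.
Qed.

Lemma Lip_sqr_in (R : realType) (f : R -> R) (a b : R) : Lip f ->
  exists K, lip_in R a b K (fun t => f t ^+ 2).
Proof.
move=> [K K0 Lf]; pose B := `|f a| + K * (b - a).
have fB t : a <= t -> t <= b -> `|f t| <= B.
  move=> at_ tb; rewrite -[f t](subrK (f a)) (le_trans (ler_normD _ _))//.
  rewrite addrC lerD2l (le_trans (Lf _ _))// ger0_norm ?subr_ge0//.
  by rewrite ler_wpM2l ?(ltW K0)// lerD2r.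
exists (K * (2 * B)) => s t as_ st tb.
rewrite subr_sqr normrM mulrAC ler_pM//.
  by rewrite (le_trans (Lf _ _))// ger0_norm ?subr_ge0.
rewrite (le_trans (ler_normD _ _))// mulr_natl mulr2n lerD ?fB//.
  exact: le_trans as_ st.
exact: le_trans st tb.
Qed.

Lemma lip_in_sum (R : realType) (I : finType) (f : I -> R -> R) (a b : R) :
  (forall i, exists K, lip_in R a b K (f i)) ->
  exists K, lip_in R a b K (fun t => \sum_i f i t).
Proof.
move=> /(_ _)/cid-/all_sig[K LK]; exists (\sum_i K i) => s t as_ st tb.
rewrite -sumrB (le_trans (ler_norm_sum _ _ _))// mulr_suml.
by apply: ler_sum => i _; exact: LK.
Qed.

Section Pair.
Context {R : realType} {N : nat} {T : R} (k : R) (G : gait N T).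
Hypothesis k0 : 0 < k.
Variables (a : R) (X Y : 'I_N -> R -> R).
Hypotheses (cX : crawling k G a X) (cY : crawling k G a Y).
Implicit Types (i l : 'I_N) (s t : R).

Let d t i : R := X i t - Y i t.

Let Lip_d i : Lip (fun t => d t i).
Proof. by have [LX _ _ _] := cX; have [LY _ _ _] := cY; exact: LipB. Qed.

(** The last two clauses come from [ae_zero_derive]: almost surely in time, components of [d] that
    coincide have equal derivatives, and a vanishing [lap d i] has derivative 0. *)
Definition regular_time t (v : 'I_N -> R) : Prop :=
  [/\ forall i, is_derive t 1 (fun s => d s i) (v i),
      forall i, lap (d t) i * v i <= 0,
      forall i, `|v i| <= gapsum v *+ 2,
      forall i l, d t i = d t l -> v i = v l &
      forall i, lap (d t) i = 0 -> lap v i = 0].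

Lemma is_derive_gap t v j : (forall i, is_derive t 1 (fun s => d s i) (v i)) ->
  is_derive t 1 (fun s => gap (d s) j) (gap v j).
Proof. by move=> dv; apply: is_derive1B; exact: dv. Qed.

Lemma is_derive_lap t v i : (forall i, is_derive t 1 (fun s => d s i) (v i)) ->
  is_derive t 1 (fun s => lap (d s) i) (lap v i).
Proof.
move=> dv; apply: (is_derive1_sum _ (fun j s => gap (d s) j * incid i j)) => j.
have := is_derive1Z (incid i j) _ _ _ (is_derive_gap _ _ j dv).
rewrite mulrC; congr is_derive; apply/funext => s; exact: mulrC.
Qed.

Lemma ae_regular_pair : {ae lebesgue_measure, forall t, a <= t -> exists u w,
  [/\ forall i, is_derive t 1 (X i) (u i),
      forall i, friction_incl G t i (u i) (forces k G X t i),
      forall i, is_derive t 1 (Y i) (w i),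
      forall i, friction_incl G t i (w i) (forces k G Y t i) &
      regular_time t (fun i => u i - w i)]}.
Proof.
have [LX _ _ _] := cX; have [LY _ _ _] := cY.
have aeX := ae_forall_fin _ _ (fun i => ae_derivable _ _ (LX i)).
have aeY := ae_forall_fin _ _ (fun i => ae_derivable _ _ (LY i)).
have aez := ae_forall_fin _ _ (fun il : 'I_N * 'I_N =>
  ae_zero_derive _ (fun t => d t il.1 - d t il.2)).
have ael := ae_forall_fin _ _ (fun i => ae_zero_derive _ (fun t => lap (d t) i)).
have := ae_conj _ _ (ae_nondegenerate G) (ae_conj _ _ (ae_conj _ _ aeX aeY) (ae_conj _ _ aez ael)).
apply: ae_mono => t [nd [[dX dY] [zd zl]]] at_.
pose u i := derive1 (X i) t; pose w i := derive1 (Y i) t.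
have dv i : is_derive t 1 (fun s => d s i) (u i - w i).
  by apply: is_derive1B; exact: is_derive1P.
have iX i := crawling_incl k G a X t i cX at_ (dX i).
have iY i := crawling_incl k G a Y t i cY at_ (dY i).
exists u, w; split => //; try by move=> i; exact: is_derive1P.
split => //.
- move=> i; have := friction_incl_monotone _ _ _ _ _ _ _ (iX i) (iY i).
  rewrite /forces forceB mulNr -mulrA oppr_ge0 pmulr_rle0//.
- by apply: (drift_bound _ _ _ _ _ _ nd iX iY); exact: force_sum0.
- move=> i l dil; have D := is_derive1B _ _ _ _ _ (dv i) (dv l).
  have := zd (i, l); rewrite /= dil subrr => /(_ erefl (is_derive1_derivable _ _ _ D)).
  by rewrite (is_derive1E _ _ _ D) => /eqP; rewrite subr_eq0 => /eqP.
- move=> i lapi; have D := is_derive_lap _ _ i dv.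
  by have := zl i lapi (is_derive1_derivable _ _ _ D); rewrite (is_derive1E _ _ _ D).
Qed.

Lemma ae_regular_time :
  {ae lebesgue_measure, forall t, a <= t -> exists v, regular_time t v}.
Proof.
have := ae_regular_pair; apply: ae_mono => t H /H[u [w [_ _ _ _ reg]]].
by exists (fun i => u i - w i).
Qed.

Definition topd (i0 : 'I_N) t : R := d t [arg max_(i > i0) d t i]%O.

Lemma topd_ge i0 t i : d t i <= topd i0 t.
Proof. by rewrite /topd; case: arg_maxP => // l _; apply. Qed.

Lemma topd_ex i0 t : exists i, topd i0 t = d t i.
Proof. by exists [arg max_(i > i0) d t i]%O. Qed.

(* Since [lap d] is nonnegative at a maximum of [d], monotonicity of friction
   makes it vanish wherever the maximum increases; then [d] is constant in space
   and all bodies drift in common, which is excluded. *)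
Lemma topd_nonincreasing i0 s t : a <= s -> s <= t -> topd i0 t <= topd i0 s.
Proof.
move=> as_ st; rewrite -subr_le0 -[leRHS](mul0r (t - s)).
have [K K0 LK] := Lip_uniform _ _ Lip_d.
apply: (lip_in_dini_le _ _ _ _ _ K) => //.
  move=> r r' _ rr' _; have [i iE] := topd_ex i0 r; have [l lE] := topd_ex i0 r'.
  have := LK i r r'; have := LK l r' r; have := topd_ge i0 r l; have := topd_ge i0 r' i.
  rewrite [`|r - r'|]distrC [`|r' - r|]ger0_norm ?subr_ge0// iE lE !ler_norml; lra.
have := ae_regular_time; apply: ae_mono => r H /andP[sr rt].
have [|v [dv dlap drift eqd _]] := H; first by rewrite (le_trans as_)// ltW.
have top_le0 i : topd i0 r = d r i -> v i <= 0.
  move=> iE; rewrite leNgt; apply/negP => vi.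
  have [z zE] : exists z, forall l, v l = z.
    exists (v i) => l; apply: (eqd l i); apply: lap_max_eq0 => m mmax.
    have mE : d r m = d r i.
      by apply/eqP; rewrite eq_le -{1}iE topd_ge mmax.
    by have := dlap m; rewrite (eqd _ _ mE) pmulr_lle0.
  have g0 : gapsum v = 0.
    by rewrite /gapsum big1// => j _; rewrite /gap !zE subrr normr0.
  by have := drift i; rewrite g0 mul0rn normr_le0 gt_eqF.
move=> e e0; have [l0 l0E] := topd_ex i0 r.
(* Just after [r] the maximum is still attained by a body that attains it at [r], because the others
   remain below [l0]; so only bodies with a Dini bound matter. *)
have [|i|D D0 DP] := @fin_pos R 'I_N (fun i D => forall u u', u <= r <= u' ->
    r - D < u -> u' < r + D ->
    if d r i == topd i0 r then d u' i - d u i <= (0 + e) * (u' - u)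
    else d u' i < d u' l0).
- move=> i D D' D'0 D'D H' u u' uru' Du Du'; apply: H' => //; lra.
- have [ie|ne] := eqVneq (d r i) (topd i0 r).
    have [D D0 DP] := derivable_dini_le _ _ 0 r
       (is_derive1_derivable _ _ _ (dv i))
       (eq_ind_r (fun z => z <= 0) (top_le0 i (esym ie)) (is_derive1E _ _ _ (dv i))) _ e0.
    by exists D.
  have pos : 0 < d r l0 - d r i.
    by rewrite subr_gt0 -l0E lt_neqAle ne topd_ge.
  have [D D0 DP] := Lip_pos_right _ _ (LipB _ _ (Lip_d l0) (Lip_d i)) pos.
  exists D => // u u' /andP[ur ru'] Du Du'.
  by rewrite -subr_gt0; apply: DP; rewrite Du' andbT; lra.
exists D => // u u' uru' Du Du'.
have [i iE] := topd_ex i0 u'; have := DP i _ _ uru' Du Du'.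
case: ifPn => [_|_ lt_i]; first by have := topd_ge i0 u i; rewrite iE; lra.
by have := topd_ge i0 u' l0; rewrite iE leNgt lt_i.
Qed.

Definition gap_energy t : R := \sum_j gap (d t) j ^+ 2.

Lemma is_derive_gap_energy t v : (forall i, is_derive t 1 (fun s => d s i) (v i)) ->
  is_derive t 1 gap_energy (2 * \sum_i lap (d t) i * v i).
Proof.
move=> dv.
have -> : 2 * (\sum_i lap (d t) i * v i) =
    \sum_j (gap (d t) j * gap v j + gap (d t) j * gap v j).
  under eq_bigr do rewrite mulrC.
  by rewrite lap_dot big_split/= mulr_natl mulr2n.
apply: (is_derive1_sum _ (fun j s => gap (d s) j ^+ 2)) => j.
by apply: (is_derive1M (fun s => gap (d s) j)); exact: is_derive_gap.
Qed.

Lemma gap_energy_nonincreasing s t : a <= s -> s <= t ->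
  gap_energy t <= gap_energy s.
Proof.
move=> as_ st; rewrite -subr_le0 -[leRHS](mul0r (t - s)).
have [K LK] : exists K, lip_in R s t K gap_energy.
  by apply: lip_in_sum => j; apply: Lip_sqr_in; apply: LipB.
apply: (lip_in_dini_le _ _ _ _ _ K) => //.
have := ae_regular_time; apply: ae_mono => r H /andP[sr rt].
have [|v [dv dlap _ _ _]] := H; first by rewrite (le_trans as_)// ltW.
have D := is_derive_gap_energy _ _ dv.
apply: derivable_dini_le; first exact: (is_derive1_derivable _ _ _ D).
rewrite (is_derive1E _ _ _ D) pmulr_rle0//.
by apply: sumr_le0 => i _; exact: dlap.
Qed.

(* Without energy loss, [lap d i * v i = 0] for all [i], so [v i] is nonzero only
   where [lap d i = 0], hence [lap v i = 0]. Thus [v] is orthogonal to [lap v]. *)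
Lemma gap_energy_cst : (forall t, a <= t -> gap_energy t = gap_energy a) ->
  forall i t, a <= t -> d t i = d a i.
Proof.
move=> Ecst i t at_; have [K K0 LK] := Lip_d i.
have dini0 : {ae lebesgue_measure, forall r, a < r < t ->
    is_derive r 1 (fun s => d s i) 0}.
  have := ae_regular_time; apply: ae_mono => r H /andP[ar rt].
  have [|v [dv dlap drift _ lap0]] := H; first by rewrite ltW.
  have E0 : \sum_i lap (d r) i * v i = 0.
    have D := is_derive_gap_energy _ _ dv.
    have D0 : is_derive r 1 gap_energy 0.
      apply: near_eq_is_derive (is_derive1_cst (gap_energy a) r).
      near=> s; apply/esym/Ecst.
      have : s \in `]a, t[ by near: s; apply: near_in_itvoo; rewrite in_itv/= ar.
      by rewrite in_itv/= => /andP[/ltW].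
    have := is_derive1E _ _ _ D; rewrite (is_derive1E _ _ _ D0) => /esym/eqP.
    by rewrite mulf_eq0 pnatr_eq0/= => /eqP.
  have term0 l : lap (d r) l * v l = 0.
    have /psumr_eq0P : forall l, true -> 0 <= - (lap (d r) l * v l).
      by move=> l' _; rewrite oppr_ge0.
    by rewrite sumrN E0 oppr0 => /(_ erefl l isT)/eqP; rewrite oppr_eq0 => /eqP.
  have vlap0 l : v l * lap v l = 0.
    have /eqP := term0 l; rewrite mulf_eq0 => /orP[/eqP/lap0->|/eqP->].
      by rewrite mulr0.
    by rewrite mul0r.
  have gap0 j : gap v j = 0.
    have /psumr_eq0P : forall j : 'I_N.-1, true -> 0 <= gap v j ^+ 2.
      by move=> *; exact: sqr_ge0.
    rewrite -lap_dotxx big1// => /(_ erefl j isT)/eqP.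
    by rewrite sqrf_eq0 => /eqP.
  have v0 l : v l = 0.
    have := drift l; rewrite /gapsum big1 => [|j _]; last by rewrite gap0 normr0.
    by rewrite mul0rn normr_le0 => /eqP.
  by rewrite -(v0 i).
have Lup := lip_in_dini_le _ (fun s => d s i) a t 0 K at_ (lexx _) (lip_lip_in _ _ _ _ _ LK).
have LKN : lip R K (fun s => - d s i) by move=> s s'; rewrite -opprD normrN; exact: LK.
have Ldn := lip_in_dini_le _ (fun s => - d s i) a t 0 K at_ (lexx _) (lip_lip_in _ _ _ _ _ LKN).
rewrite mul0r in Lup Ldn.
apply/eqP; rewrite -subr_eq0 eq_le Lup/=; last first.
  move: dini0; apply: ae_mono => r H /H D.
  apply: derivable_dini_le; first exact: (is_derive1_derivable _ _ _ D).
  by rewrite (is_derive1E _ _ _ D).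
suff : - d t i - - d a i <= 0 by lra.
apply: Ldn; move: dini0; apply: ae_mono => r H /H D.
have DN : is_derive r 1 (fun s => - d s i) (- 0) by exact: is_deriveN.
apply: derivable_dini_le; first exact: (is_derive1_derivable _ _ _ DN).
by rewrite (is_derive1E _ _ _ DN) oppr0.
Unshelve. all: by end_near. Qed.

End Pair.

(** * Solutions are Lipschitz motions *)

Lemma ae_exists_itv (R : realType) (P : R -> Prop) (a b : R) : a < b ->
  {ae lebesgue_measure, forall t, P t} -> exists2 t, a < t < b & P t.
Proof.
move=> ab [E [mE E0 sE]]; apply: contrapT => nP.
have sub : `]a, b[%classic `<=` E.
  move=> t /=; rewrite in_itv/= => tab; apply: sE => /= Pt; apply: nP.
  by exists t.
have : (lebesgue_measure (`]a, b[%classic : set R) <= lebesgue_measure E)%E.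
  by apply: le_measure; rewrite ?inE.
have -> : lebesgue_measure E = 0%E by exact: E0.
by rewrite lebesgue_measure_itv/= lte_fin ab -EFinD lee_fin subr_le0 leNgt ab.
Qed.

Lemma abs_cont_sub (R : realType) (f : R -> R) (a b s t : R) :
  a <= s -> t <= b -> abs_cont a b f -> abs_cont s t f.
Proof.
move=> as_ tb acf e e0; have [d d0 dP] := acf e e0; exists d => // n u v uv.
by apply: dP => i; have [su uvi vt] := uv i; split => //; [exact: le_trans su|exact: le_trans vt tb].
Qed.

Lemma abs_cont_coord (R : realType) (N : nat) (f : R -> 'rV[R]_N) (a b : R) (i : 'I_N) :
  abs_cont a b f -> abs_cont a b (fun t => f t 0 i).
Proof.
move=> acf e e0; have [d d0 dP] := acf e e0; exists d => // n u v uv tuv sumd.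
apply: le_lt_trans (dP _ _ _ uv tuv sumd); apply: ler_sum => l _.
rewrite [leRHS]/Num.Def.normr/= mx_normrE; apply: le_trans; last exact: (le_bigmax _ _ (0, i)).
by rewrite !mxE.
Qed.

Lemma abs_contN (R : realType) (f : R -> R) (a b : R) :
  abs_cont a b f -> abs_cont a b (fun t => - f t).
Proof.
move=> acf e e0; have [d d0 dP] := acf e e0; exists d => // n u v uv tuv sumd.
apply: le_lt_trans (dP _ _ _ uv tuv sumd); apply: ler_sum => l _.
by rewrite -opprD normrN.
Qed.

Lemma abs_cont_right (R : realType) (f : R -> R) (a b e : R) : a < b ->
  abs_cont a b f -> 0 < e ->
  exists2 d, 0 < d & forall s, a <= s -> s < a + d -> `|f s - f a| < e.
Proof.
move=> ab acf e0; have [d d0 dP] := acf e e0.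
exists (Num.min d (b - a)); first by rewrite lt_min d0 subr_gt0.
move=> s as_ sd.
have {}sd : s - a < Num.min d (b - a) by lra.
have /andP[s1 s2] : (s - a < d) && (s - a < b - a) by rewrite -lt_min.
have := dP 1%N (fun=> a) (fun=> s); rewrite !big_ord1; apply => //.
- by move=> i; split => //; lra.
- by move=> i l _ _ _; rewrite !ord1.
Qed.

Section Solution_crawls.
Context {R : realType} {N : nat} {T : R} (k : R) (G : gait N T).
Hypothesis k0 : 0 < k.

(** Time enters the force only through the rest lengths, whose contribution is independent of
    [y]. *)
Lemma force_time_lip : exists2 K, 0 < K & forall (y : 'I_N -> R) i s t,
  `|force k G s y i - force k G t y i| <= K * `|s - t|.
Proof.
have L0 i : Lip (fun t => forces k G (fun _ _ => 0) t i).
  by apply: Lip_forces => l; exact: Lip_cst.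
have [K K0 LK] := Lip_uniform _ _ L0.
exists K => // y i s t.
have -> : force k G s y i - force k G t y i = force k G s (fun=> 0) i - force k G t (fun=> 0) i.
  have := forceB k G s y (fun=> 0) i; have := forceB k G t y (fun=> 0) i; lra.
exact: LK.
Qed.

Lemma gmu_ge0 t i : 0 <= gmup G i t /\ 0 <= gmum G i t.
Proof.
have [a1 [a2 [a10 _ H]]] := gmu_bounds G; have [/andP[? _] /andP[? _]] := H i t.
by split; exact: le_trans (ltW a10) _.
Qed.

Variables (t0 : R) (x : R -> 'rV[R]_N).
Hypothesis solx : solution k G t0 x.

Let y t i : R := x t 0 i.

Let acy i s t : t0 <= s -> s <= t -> abs_cont s t (fun r => y r i).
Proof.
move=> ts st; have [acx _] := solx; apply: (abs_cont_sub _ _ t0 t) => //.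
by apply: abs_cont_coord; apply: acx; exact: le_trans st.
Qed.

Let ae_incl : {ae lebesgue_measure, forall t, t0 <= t -> exists u,
  forall i, is_derive t 1 (fun s => y s i) (u i) /\
    friction_incl G t i (u i) (force k G t (y t) i)}.
Proof.
have [_ aex] := solx; move: aex; apply: ae_mono => t H /H[dx [xi xiR grad0]].
exists (fun i => derive1 (fun s => y s i) t) => i.
have dxi := (derivable_mxP x t 1).1 dx ord0 i.
split; first exact: is_derive1P.
have xiE : xi = - gradient (energy k G t) (x t).
  by apply/eqP; rewrite -addr_eq0 addrC; apply/eqP.
have mup0 l : 0 <= gmup G l t by have [] := gmu_ge0 t l.
have mum0 l : 0 <= gmum G l t by have [] := gmu_ge0 t l.
have := subdifferential_dissipation _ _ _ _ mup0 mum0 xiR i.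
by rewrite xiE gradient_energyE derive1E derive_mx// mxE derive1E.
Qed.

Lemma solution_forces_right i t e : t0 <= t -> 0 < e ->
  exists2 d, 0 < d & forall s, t <= s -> s < t + d ->
    `|force k G s (y s) i - force k G t (y t) i| < e.
Proof.
move=> tt e0; have [K K0 LK] := force_time_lip.
(* Chosen so that [lap_bound] makes the effect of the change of [y] at most [e / 2]. *)
pose e1 := e / (4 * (k * (N%:R + 1))).
have kN0 : 0 < k * (N%:R + 1) by rewrite mulr_gt0// ltr_wpDl.
have e10 : 0 < e1 by rewrite divr_gt0// mulr_gt0.
have [|l|d d0 dP] := @fin_pos R 'I_N (fun l d => forall s, t <= s -> s < t + d ->
    `|y s l - y t l| < e1).
- by move=> l d d' d'0 d'd H s ts sd; apply: H => //; lra.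
- apply: (abs_cont_right _ _ _ (t + 1)) => //; first by rewrite ltrDl.
  by apply: acy => //; rewrite lerDl.
exists (Num.min d (e / (4 * K))); first by rewrite lt_min d0 divr_gt0// mulr_gt0.
move=> s ts sd; have {}sd : s - t < Num.min d (e / (4 * K)) by lra.
have /andP[s1 s2] : (s - t < d) && (s - t < e / (4 * K)) by rewrite -lt_min.
have yl l : `|y s l - y t l| <= e1 by apply/ltW/dP => //; lra.
have b1 := lap_bound _ _ i (ltW e10) yl.
have b2 := LK (y t) i s t; rewrite [`|s - t|]ger0_norm ?subr_ge0// in b2.
have b3 : K * (s - t) < e / 4.
  have -> : e / 4 = K * (e / (4 * K)) by field; rewrite gt_eqF.
  by rewrite ltr_pM2l.
have b4 : k * `|lap (fun l => y s l - y t l) i| <= e / 2.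
  apply: (@le_trans _ _ (k * (N%:R * (2 * e1)))); first by rewrite ler_pM2l.
  have -> : e / 2 = k * ((N%:R + 1) * (2 * e1)).
    by rewrite /e1; field; rewrite gt_eqF// gt_eqF// ltr_wpDl.
  by rewrite ler_pM2l//; nra.
have := forceB k G s (y s) (y t) i => fB.
have : `|force k G s (y s) i - force k G s (y t) i| <= e / 2.
  by rewrite fB normrN normrM gtr0_norm.
move=> b5; have -> : force k G s (y s) i - force k G t (y t) i =
  (force k G s (y s) i - force k G s (y t) i) + (force k G s (y t) i - force k G t (y t) i).
  by ring.
apply: (le_lt_trans (ler_normD _ _)); lra.
Qed.

(** The inclusion gives the bounds at almost every time; right continuity of the forces extends them
    to all times, [t0] included. *)
Lemma solution_forces_bounds i t : t0 <= t ->
  - gmum G i t <= force k G t (y t) i <= gmup G i t.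
Proof.
move=> tt.
have dense d : 0 < d -> exists2 s, t < s < t + d &
    - gmum G i s <= force k G s (y s) i <= gmup G i s.
  move=> d0; have [|s tsd H] := ae_exists_itv _ _ t (t + d) _ ae_incl; first by rewrite ltrDl.
  exists s => //; have [|u /(_ i)[_ []//]] := H.
  by rewrite (le_trans tt)//; apply/ltW; case/andP: tsd.
apply/andP; split; rewrite leNgt; apply/negP => lt_t.
- pose h := (- gmum G i t - force k G t (y t) i) / 2.
  have h0 : 0 < h by rewrite divr_gt0// subr_gt0.
  have Lg : Lip (fun s => - gmum G i s - (force k G t (y t) i + h)).
    by apply: LipB; [exact/LipN/Lip_gmum|exact: Lip_cst].
  have [|d1 d10 d1P] := Lip_pos_right _ t Lg; first by rewrite /h; lra.
  have [d2 d20 d2P] := solution_forces_right i _ _ tt h0.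
  have [|s /andP[ts sd] /andP[lo _]] := dense (Num.min d1 d2).
    by rewrite lt_min d10.
  have {}sd : s - t < Num.min d1 d2 by lra.
  have /andP[s1 s2] : (s - t < d1) && (s - t < d2) by rewrite -lt_min.
  have [P1 P2] : t <= s /\ s < t + d2 by split; lra.
  have := d2P s P1 P2; have := d1P s; rewrite ltr_norml => H1 /andP[_ H2].
  have : 0 < - gmum G i s - (force k G t (y t) i + h) by apply: H1; lra.
  lra.
- pose h := (force k G t (y t) i - gmup G i t) / 2.
  have h0 : 0 < h by rewrite divr_gt0// subr_gt0.
  have Lg : Lip (fun s => force k G t (y t) i - h - gmup G i s).
    by apply: LipB; [exact: Lip_cst|exact: Lip_gmup].
  have [|d1 d10 d1P] := Lip_pos_right _ t Lg; first by rewrite /h; lra.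
  have [d2 d20 d2P] := solution_forces_right i _ _ tt h0.
  have [|s /andP[ts sd] /andP[_ hi]] := dense (Num.min d1 d2).
    by rewrite lt_min d10.
  have {}sd : s - t < Num.min d1 d2 by lra.
  have /andP[s1 s2] : (s - t < d1) && (s - t < d2) by rewrite -lt_min.
  have [P1 P2] : t <= s /\ s < t + d2 by split; lra.
  have := d2P s P1 P2; have := d1P s; rewrite ltr_norml => H1 /andP[H2 _].
  have : 0 < force k G t (y t) i - h - gmup G i s by apply: H1; lra.
  lra.
Qed.

(* When body [i] moves, its force touches a friction bound, so to the left of [t]
   it varies no faster than the bound; this controls [u i * lap u i] from above,
   hence the gaps of [u], and [u] itself because there is no common drift. *)
Lemma solution_speed_bound : exists2 K, 0 < K &
  {ae lebesgue_measure, forall t, t0 < t -> exists u,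
    forall i, [/\ is_derive t 1 (fun s => y s i) (u i),
      friction_incl G t i (u i) (force k G t (y t) i) & `|u i| <= K]}.
Proof.
have [KL KL0 LL] := force_time_lip.
have [Kp Kp0 Lp] := Lip_uniform _ _ (Lip_gmup G).
have [Km Km0 Lm] := Lip_uniform _ _ (Lip_gmum G).
pose K1 := Kp + Km + KL; have K10 : 0 < K1 by rewrite !addr_gt0.
(* Let S be [gapsum u]. Then k |D u|^2 <= K1 N (2 S) and S^2 <= N |D u|^2 give S <= 2 N^2 K1 / k,
   while each speed is at most 2 S. Adding 1 makes the constant positive. *)
exists (4 * N%:R ^+ 2 * K1 / k + 1).
  by rewrite ltr_wpDl// divr_ge0 ?(ltW k0)// mulr_ge0 ?(ltW K10)// mulr_ge0// exprn_ge0.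
have := ae_conj _ _ (ae_nondegenerate G) ae_incl.
apply: ae_mono => t [nd H] t0t; have [u uP] := H (ltW t0t).
exists u => i.
have tt0 : 0 < t - t0 by rewrite subr_gt0.
have dlap l : is_derive t 1 (fun s => lap (y s) l) (lap u l).
  apply: (is_derive1_sum _ (fun j s => gap (y s) j * incid l j)) => j.
  have dgap : is_derive t 1 (fun s => gap (y s) j) (gap u j).
    by apply: is_derive1B; have [] := uP (ord_next j); have [] := uP (ord_this j).
  have := is_derive1Z (incid l j) _ _ _ dgap.
  by rewrite mulrC; congr is_derive; apply/funext => s; exact: mulrC.
have force_diff l s : force k G s (y s) l - force k G t (y t) l =
    - (k * (lap (y s) l - lap (y t) l)) + (force k G s (y t) l - force k G t (y t) l).
  by have := forceB k G s (y s) (y t) l; rewrite lapB; lra.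
have pos_lap l : 0 < u l -> k * lap u l <= K1.
  move=> u0; have [dul [_ up _]] := uP l.
  have dk := is_derive1Z (- k) _ _ _ (dlap l).
  suff : - K1 <= - k * lap u l by lra.
  rewrite -(is_derive1E _ _ _ dk).
  apply: (derive_ge_left _ _ _ _ _ tt0) => [|s s1 st]; first exact: is_derive1_derivable dk.
  have ts : t0 <= s by lra.
  have /andP[_ hi] := solution_forces_bounds l s ts.
  have := LL (y t) l s t; have := Lp l s t; have := force_diff l s.
  rewrite (up u0) [`|s - t|]ltr0_norm ?subr_lt0// !ler_norml /K1.
  have : 0 < Km * (t - s) by rewrite mulr_gt0// subr_gt0.
  lra.
have neg_lap l : u l < 0 -> - K1 <= k * lap u l.
  move=> u0; have [dul [_ _ un]] := uP l.
  have dk := is_derive1Z k _ _ _ (dlap l).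
  rewrite -(is_derive1E _ _ _ dk).
  apply: (derive_ge_left _ _ _ _ _ tt0) => [|s s1 st]; first exact: is_derive1_derivable dk.
  have ts : t0 <= s by lra.
  have /andP[lo _] := solution_forces_bounds l s ts.
  have := LL (y t) l s t; have := Lm l s t; have := force_diff l s.
  rewrite (un u0) [`|s - t|]ltr0_norm ?subr_lt0// !ler_norml /K1.
  have : 0 < Kp * (t - s) by rewrite mulr_gt0// subr_gt0.
  lra.
have ulap l : u l * (k * lap u l) <= K1 * `|u l|.
  have [u0|u0|->] := ltgtP (u l) 0; last by rewrite normr0 mul0r mulr0.
  - by rewrite (ltr0_norm u0); have := neg_lap l u0; nra.
  - by rewrite (gtr0_norm u0) mulrC ler_pM2r//; exact: pos_lap.
(* Comparison with a body at rest under zero force turns [drift_bound] into a bound on [u]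
   itself. *)
have eta_incl l : friction_incl G t l 0 0.
  have [p m] := gmu_ge0 t l; split; rewrite ?ltxx//.
  by rewrite oppr_le0 m p.
have uP2 l := (uP l).2.
have ub := drift_bound _ _ _ _ _ _ nd uP2 eta_incl (force_sum0 _ _ _ _).
have {}ub l : `|u l| <= gapsum u *+ 2.
  have := ub _ l; rewrite sumr_const mul0rn => /(_ erefl).
  rewrite subr0 /gapsum; under eq_bigr do rewrite gapB gap_cst subr0.
  by [].
have [ul il] := uP i; split => //; apply: (le_trans (ub i)).
have S0 := gapsum_ge0 u; have Ssq := gapsum_sqr u.
have : k * (\sum_j gap u j ^+ 2) <= K1 * (N%:R * (gapsum u *+ 2)).
  rewrite -lap_dotxx mulr_sumr.
  apply: (@le_trans _ _ (\sum_i K1 * `|u i|)).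
    by apply: ler_sum => l _; rewrite mulrCA.
  rewrite -mulr_sumr ler_pM2l//.
  apply: (le_trans (ler_sum _ (fun l _ => ub l))).
  by rewrite sumr_const card_ord mulr_natl.
move=> kS.
have S2 : k * gapsum u ^+ 2 <= 2 * N%:R ^+ 2 * K1 * gapsum u.
  apply: (@le_trans _ _ (k * (N%:R * \sum_j gap u j ^+ 2))); first by rewrite ler_pM2l.
  rewrite mulrCA; apply: (@le_trans _ _ (N%:R * (K1 * (N%:R * (gapsum u *+ 2))))).
    by rewrite ler_wpM2l.
  by rewrite le_eqVlt; apply/orP; left; apply/eqP; rewrite mulr2n; ring.
have [->|nS] := eqVneq (gapsum u) 0.
  by rewrite mul0rn ltW// ltr_wpDl// divr_ge0 ?(ltW k0)// mulr_ge0 ?(ltW K10)// mulr_ge0// exprn_ge0.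
have Sp : 0 < gapsum u by rewrite lt_neqAle eq_sym nS.
rewrite expr2 mulrA ler_pM2r// in S2.
have : gapsum u <= 2 * N%:R ^+ 2 * K1 / k by rewrite ler_pdivlMr// mulrC.
rewrite mulr2n; lra.
Qed.

(** Freezing the motion before [t0] makes it Lipschitz on the whole line. The monotonicity clauses
    integrate the sign that the inclusion imposes on the velocity while a bound is not reached. *)
Lemma solution_crawling :
  crawling k G t0 (fun i t => x (Num.max t t0) 0 i).
Proof.
have mx t : t0 <= t -> Num.max t t0 = t by move=> ?; rewrite max_l.
have fE t i : t0 <= t -> forces k G (fun i t => x (Num.max t t0) 0 i) t i =
    force k G t (y t) i by move=> tt; rewrite /forces mx.
have [K K0 aeK] := solution_speed_bound.
have mono i s t : t0 <= s -> s <= t -> forall c : R, 0 <= c ->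
    {ae lebesgue_measure, forall r, s < r < t -> forall v,
       is_derive r 1 (fun s => y s i) v -> friction_incl G r i v (force k G r (y r) i) ->
       v <= c} -> y t i - y s i <= c * (t - s).
  move=> ts st c c0 H; apply: (abs_cont_dini_le _ (fun r => y r i)) => //; first exact: acy.
  have := ae_conj _ _ H aeK; apply: ae_mono => r [H1 H2] srt.
  have [|u /(_ i)[du inc _]] := H2; first by rewrite (le_lt_trans ts)//; case/andP: srt.
  apply: derivable_dini_le; first exact: is_derive1_derivable du.
  by rewrite (is_derive1E _ _ _ du); exact: H1.
have monoN i s t : t0 <= s -> s <= t -> forall c : R, 0 <= c ->
    {ae lebesgue_measure, forall r, s < r < t -> forall v,
       is_derive r 1 (fun s => y s i) v -> friction_incl G r i v (force k G r (y r) i) ->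
       - v <= c} -> - y t i - - y s i <= c * (t - s).
  move=> ts st c c0 H; apply: (abs_cont_dini_le _ (fun r => - y r i)) => //.
    by apply: abs_contN; exact: acy.
  have := ae_conj _ _ H aeK; apply: ae_mono => r [H1 H2] srt.
  have [|u /(_ i)[du inc _]] := H2; first by rewrite (le_lt_trans ts)//; case/andP: srt.
  have duN : is_derive r 1 (fun s => - y s i) (- u i) by exact: is_deriveN.
  apply: derivable_dini_le; first exact: is_derive1_derivable duN.
  by rewrite (is_derive1E _ _ _ duN); exact: H1.
have Lip_y i s t : t0 <= s -> s <= t -> `|y t i - y s i| <= K * (t - s).
  move=> ts st.
  have H : {ae lebesgue_measure, forall r, s < r < t -> forall v,
       is_derive r 1 (fun s => y s i) v -> `|v| <= K}.
    move: aeK; apply: ae_mono => r H2 srt v dv.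
    have [|u /(_ i)[du _ uK]] := H2; first by rewrite (le_lt_trans ts)//; case/andP: srt.
    by rewrite -(is_derive1E _ _ _ dv) (is_derive1E _ _ _ du).
  have H1 := mono i s t ts st K (ltW K0).
  have H2 := monoN i s t ts st K (ltW K0).
  rewrite ler_norml; apply/andP; split; last first.
    apply: H1; move: H; apply: ae_mono => r H srt v dv _.
    exact: le_trans (ler_norm _) (H srt v dv).
  suff : - y t i - - y s i <= K * (t - s) by lra.
  apply: H2; move: H; apply: ae_mono => r H srt v dv _.
  by rewrite (le_trans (ler_norm _))// normrN; exact: H srt v dv.
split.
- move=> i; exists K => // s t; wlog st : s t / s <= t.
    by move=> H; have [/H//|/ltW/H] := leP s t; rewrite distrC [`|t - s|]distrC.
  rewrite distrC (le_trans (Lip_y i (Num.max s t0) (Num.max t t0) _ _))//.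
  + by rewrite le_max lexx orbT.
  + by rewrite ge_max !le_max st lexx orbT.
  + rewrite ler_pM2l// [`|s - t|]distrC ger0_norm ?subr_ge0//.
    case: (leP s t0) => h1; case: (leP t t0) => h2.
    - by rewrite subrr subr_ge0.
    - by rewrite lerD2l lerN2.
    - by rewrite lerD2r; move: (lt_le_trans (lt_le_trans h1 st) h2); rewrite ltxx.
    - by [].
- by move=> i t tt; rewrite fE//; exact: solution_forces_bounds.
- move=> i s t ts st lt_mu /=; rewrite !mx ?(le_trans ts)// -subr_le0.
  rewrite -[leRHS](mul0r (t - s)); apply: mono => //.
  apply: aeW => r srt v _ [_ vp _]; rewrite leNgt; apply/negP => /vp E.
  have := lt_mu r; rewrite fE ?E ?ltxx; last by case/andP: srt => /ltW sr _; exact: le_trans sr.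
  by case/andP: srt => /ltW -> /ltW -> /(_ isT).
- move=> i s t ts st lt_mu /=; rewrite !mx ?(le_trans ts)//.
  suff : - y t i - - y s i <= 0 * (t - s) by rewrite mul0r opprK addrC subr_le0.
  apply: monoN => //.
  apply: aeW => r srt v _ [_ _ vn]; rewrite leNgt oppr_gt0; apply/negP => /vn E.
  have := lt_mu r; rewrite fE ?E ?ltxx; last by case/andP: srt => /ltW sr _; exact: le_trans sr.
  by case/andP: srt => /ltW -> /ltW -> /(_ isT).
Qed.

End Solution_crawls.

(** * Limits of shifted motions *)

Lemma ultra_fmap (T S : Type) (U : set_system T) (f : T -> S) :
  UltraFilter U -> UltraFilter (f @ U).
Proof.
move=> UU; have PU : ProperFilter U by exact: ultra_proper.
apply: Build_UltraFilter.
move=> G PG UG; apply/seteqP; split => // A GA.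
have [//|UC] := in_ultra_setVsetC (f @^-1` A) UU.
have GC : G (~` A) by apply: UG.
by case: (filter_not_empty G); rewrite -(setICr A); exact: filterI.
Qed.

Lemma ultra_bounded_cvg (R : realType) (U : set_system nat) (f : nat -> R) (B : R) :
  UltraFilter U -> (forall q, `|f q| <= B) -> exists l : R, f q @[q --> U] --> l.
Proof.
move=> UU fB; have PU : ProperFilter U by exact: ultra_proper.
have := @segment_compact R (- B) B; rewrite compact_ultra => H.
have [|l [_ fl]] := H _ (ultra_fmap _ _ U f UU); last by exists l.
have fB' : f @^-1` `[- B, B] = setT.
  by apply/seteqP; split => // q _; rewrite /= in_itv/= -ler_norml.
by rewrite /fmap/= fB'; exact: filterT.
Qed.

Lemma cvg_fin_sum (R : realType) (S : Type) (F : set_system S) (I : finType)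
    (f : I -> S -> R) (l : I -> R) : Filter F ->
  (forall i, f i q @[q --> F] --> l i) ->
  \sum_i f i q @[q --> F] --> \sum_i l i.
Proof.
move=> FF fl; have : forall r : seq I, \sum_(i <- r) f i q @[q --> F] --> \sum_(i <- r) l i.
  elim=> [|i r IH]; first by under eq_fun do rewrite big_nil; rewrite big_nil; exact: cvg_cst.
  by under eq_fun do rewrite big_cons; rewrite big_cons; exact: cvgD.
exact.
Qed.

Section Limits.
Context {R : realType} {N : nat} {T : R} (k : R) (G : gait N T).
Hypothesis k0 : 0 < k.
Implicit Types (X Y : 'I_N -> R -> R) (i l : 'I_N) (a s t : R).

Lemma cvg_gap (S : Type) (F : set_system S) (f : 'I_N -> S -> R) x j : Filter F ->
  (forall i, f i q @[q --> F] --> x i) ->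
  gap (fun l => f l q) j @[q --> F] --> gap x j.
Proof. by move=> FF fx; apply: cvgB; exact: fx. Qed.

Lemma cvg_force (S : Type) (F : set_system S) (f : 'I_N -> S -> R) x t i : Filter F ->
  (forall i, f i q @[q --> F] --> x i) ->
  force k G t (fun l => f l q) i @[q --> F] --> force k G t x i.
Proof.
move=> FF fx; apply: cvgN; apply: cvgM; first exact: cvg_cst.
apply: cvg_fin_sum => j; apply: cvgM; last exact: cvg_cst.
by apply: cvgB; [exact: cvg_gap|exact: cvg_cst].
Qed.

(** Bounded forces confine the shape. Pairing them with [x i - x i0] bounds k |D x|^2 by (k M + 2 N
    C) S, where S is [gapsum x]; since S^2 <= N |D x|^2, this bounds S by [B1]. *)
Lemma osc_bound t : exists B, forall x : 'I_N -> R,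
  (forall i, - gmum G i t <= force k G t x i <= gmup G i t) ->
  forall i l, `|x i - x l| <= B.
Proof.
pose C := \sum_i (gmup G i t + gmum G i t).
pose M := \sum_j `|gL G j t|.
have C0 : 0 <= C by apply: sumr_ge0 => i _; have [? ?] := gmu_ge0 G t i; exact: addr_ge0.
have M0 : 0 <= M by exact: sumr_ge0.
pose B1 := N%:R * (k * M + N%:R * (2 * C)) / k.
have B10 : 0 <= B1.
  by rewrite divr_ge0 ?(ltW k0)// mulr_ge0// addr_ge0 ?mulr_ge0// ltW.
exists (B1 *+ 2) => x bx.
have fC i : `|force k G t x i| <= C.
  have /andP[lo hi] := bx i; have [p m] := gmu_ge0 G t i.
  apply: (@le_trans _ _ (gmup G i t + gmum G i t)); first by rewrite ler_norml; lra.
  rewrite /C (bigD1 i)//= lerDl; apply: sumr_ge0 => l _.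
  by have [? ?] := gmu_ge0 G t l; exact: addr_ge0.
have ML j : `|gL G j t| <= M.
  by rewrite /M (bigD1 j)//= lerDl; exact: sumr_ge0.
suff S1 : gapsum x <= B1.
  by move=> i l; rewrite (le_trans (le_gapsum x i l))// lerMn2r.
have [S0|] := leP (gapsum x) 0; first exact: le_trans S0 B10.
move=> S0; have [i0 _] : exists i0 : 'I_N, True.
  apply: contrapT => nI; move: S0; rewrite /gapsum big1 ?ltxx// => j.
  by case: nI; exists (ord_this j).
have energy_eq : \sum_i (x i - x i0) * force k G t x i =
    - (k * \sum_j (gap x j - gL G j t) * gap x j).
  under eq_bigr do rewrite mulrBl.
  rewrite sumrB -mulr_sumr force_sum0 mulr0 subr0 -incid_dot_sum mulr_sumr -sumrN.
  by apply: eq_bigr => i _; rewrite /force mulrN mulrCA.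
have work : `|\sum_i (x i - x i0) * force k G t x i| <= N%:R * (2 * C) * gapsum x.
  apply: (le_trans (ler_norm_sum _ _ _)).
  apply: (@le_trans _ _ (\sum_(i < N) (2 * C) * gapsum x)); last first.
    by rewrite sumr_const card_ord -[X in X <= _]mulr_natl mulrA.
  apply: ler_sum => i _; rewrite normrM.
  have -> : 2 * C * gapsum x = (gapsum x *+ 2) * C by rewrite mulr2n; ring.
  by rewrite ler_pM// le_gapsum.
have Sq : k * \sum_j gap x j ^+ 2 <= (k * M + N%:R * (2 * C)) * gapsum x.
  have E : \sum_j (gap x j - gL G j t) * gap x j =
      \sum_j gap x j ^+ 2 - \sum_j gL G j t * gap x j.
    by rewrite -sumrB; apply: eq_bigr => j _; ring.
  have LS : `|\sum_j gL G j t * gap x j| <= M * gapsum x.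
    apply: (le_trans (ler_norm_sum _ _ _)); rewrite /gapsum mulr_sumr.
    by apply: ler_sum => j _; rewrite normrM ler_wpM2r.
  rewrite energy_eq E in work.
  have LS' : k * \sum_j gL G j t * gap x j <= k * (M * gapsum x).
    by rewrite ler_pM2l// (le_trans (ler_norm _)).
  by move: work; rewrite ler_norml; lra.
have Ssq := gapsum_sqr x.
rewrite /B1 ler_pdivlMr// -(ler_pM2r S0).
have : k * gapsum x ^+ 2 <= N%:R * (k * \sum_j gap x j ^+ 2).
  by rewrite [leRHS]mulrCA ler_pM2l.
have : N%:R * (k * \sum_j gap x j ^+ 2) <= N%:R * ((k * M + N%:R * (2 * C)) * gapsum x).
  by rewrite ler_wpM2l.
rewrite expr2; lra.
Qed.

Lemma crawling_shift a X (q : nat) (c : R) : crawling k G a X ->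
  crawling k G (a - q%:R * T) (fun i t => X i (t + q%:R * T) + c).
Proof.
move=> [LX adm mup mum].
have fE t i : forces k G (fun i t => X i (t + q%:R * T) + c) t i =
    forces k G X (t + q%:R * T) i.
  by rewrite /forces force_shift force_periodic.
split.
- by move=> i; apply: LipD; [exact: Lip_shift|exact: Lip_cst].
- move=> i t; rewrite lerBlDr => /(adm i).
  by rewrite fE gmup_periodicn gmum_periodicn.
- move=> i s t; rewrite lerBlDr => as_ st H; rewrite lerD2r mup// ?lerD2r//.
  move=> r /andP[sr rt]; have := H (r - q%:R * T).
  rewrite fE subrK -(gmup_periodicn G _ _ q) subrK; apply.
  by rewrite lerBrDr sr lerBlDr.
- move=> i s t; rewrite lerBlDr => as_ st H; rewrite lerD2r mum// ?lerD2r//.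
  move=> r /andP[sr rt]; have := H (r - q%:R * T).
  rewrite fE subrK -(gmum_periodicn G _ _ q) subrK; apply.
  by rewrite lerBrDr sr lerBlDr.
Qed.

End Limits.

(** * The limit of the recentred shifts and its attraction *)

Section Omega_limit.
Context {R : realType} {N : nat} {T : R} (k : R) (G : gait N T).
Hypotheses (k0 : 0 < k) (T0 : 0 < T).
Variables (t0 : R) (X : 'I_N -> R -> R) (i0 : 'I_N).
Hypothesis cX : crawling k G t0 X.
Variable U : set_system nat.
Hypotheses (UU : UltraFilter U) (Uoo : \oo `<=` U).

Let PU : ProperFilter U. Proof. exact: ultra_proper. Qed.

(* Limits along an ultrafilter exist at all times at once, with no extraction of
   subsequences. *)
Definition shifted q i t : R := X i (t + q%:R * T) - X i0 (t0 + q%:R * T).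

Lemma near_large c : \forall q \near U, c <= q%:R * T.
Proof.
apply: Uoo; exists (Num.truncn (c / T)).+1 => // q /= nq.
rewrite -ler_pdivrMr//; apply: le_trans (ltW (truncnS_gt _)) _.
by rewrite ler_nat.
Qed.

Lemma shifted_cvg i t : exists l : R, shifted q i t @[q --> U] --> l.
Proof.
have [LX adm _ _] := cX; have [B BP] := osc_bound k G k0 t0.
have [K K0 LK] := LX i.
apply: (ultra_bounded_cvg _ _ _ (B + K * `|t - t0|)) => // q.
have tq : t0 <= t0 + q%:R * T by rewrite lerDl mulr_ge0// ltW.
have osc : `|X i (t0 + q%:R * T) - X i0 (t0 + q%:R * T)| <= B.
  apply: (BP (fun l => X l (t0 + q%:R * T))) => l; have := adm l _ tq.
  by rewrite /forces force_periodic gmup_periodicn gmum_periodicn.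
have lipt := LK (t + q%:R * T) (t0 + q%:R * T).
have E : t + q%:R * T - (t0 + q%:R * T) = t - t0 by ring.
rewrite E in lipt; rewrite addrC /shifted.
apply: le_trans (lerD lipt osc); apply: le_trans (ler_normD _ _).
by rewrite addrA subrK.
Qed.

Definition omega_limit i t : R := sval (cid (shifted_cvg i t)).

Lemma omega_limit_cvg i t : shifted q i t @[q --> U] --> omega_limit i t.
Proof. exact: (svalP (cid (shifted_cvg i t))). Qed.

Lemma shifted_force q t i :
  force k G t (fun l => shifted q l t) i = forces k G X (t + q%:R * T) i.
Proof.
rewrite /forces force_periodic /shifted.
exact: (force_shift k G t (fun l => X l (t + q%:R * T)) (- X i0 (t0 + q%:R * T)) i).
Qed.

Lemma forces_omega_limit t i :
  forces k G X (t + q%:R * T) i @[q --> U] --> forces k G omega_limit t i.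
Proof.
under eq_fun do rewrite -shifted_force.
apply: (cvg_force k G _ U (fun l q => shifted q l t) (fun l => omega_limit l t)) => l.
exact: omega_limit_cvg.
Qed.

Lemma Lip_omega_limit i : Lip (omega_limit i).
Proof.
have [LX _ _ _] := cX; have [K K0 LK] := LX i; exists K => // s t.
have sub : `|shifted q i s - shifted q i t| @[q --> U] --> `|omega_limit i s - omega_limit i t|.
  by apply: cvg_norm; apply: cvgB; exact: omega_limit_cvg.
apply: (ler_cvg_to sub (cvg_cst _)); apply: nearW => q.
have -> : shifted q i s - shifted q i t = X i (s + q%:R * T) - X i (t + q%:R * T).
  by rewrite /shifted; ring.
have -> : s - t = (s + q%:R * T) - (t + q%:R * T) by ring.
exact: LK.
Qed.

(** Any starting time is allowed since the shifts start at t0 - q T. In the monotonicity clauses,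
    the limit force misses the bound by [h] at [c]; for large [q] the shifts miss it on an interval
    whose length [h / 2 / K] does not depend on [q], and continuous induction joins these
    intervals. *)
Lemma omega_limit_crawling a : crawling k G a omega_limit.
Proof.
have [LX adm mup mum] := cX; split.
- exact: Lip_omega_limit.
- move=> i t _; have cv := forces_omega_limit t i.
  have large := near_large (t0 - t).
  apply/andP; split.
    apply: (ler_cvg_to (cvg_cst (- gmum G i t)) cv).
    move: large; apply: filterS => q; rewrite lerBlDl => /(adm i)/andP[+ _].
    by rewrite gmum_periodicn.
  apply: (ler_cvg_to cv (cvg_cst (gmup G i t))).
  move: large; apply: filterS => q; rewrite lerBlDl => /(adm i)/andP[_].
  by rewrite gmup_periodicn.
- move=> i s t _ st lt_mu.
  apply: (@continuous_induction R s t (fun r => omega_limit i r <= omega_limit i s)) => //.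
  move=> c sct.
  have [K K0 LK] := LipB _ _ (Lip_gmup G i) (Lip_forces k G X i LX).
  set h := gmup G i c - forces k G omega_limit c i.
  have h0 : 0 < h by rewrite subr_gt0 lt_mu.
  exists (h / 2 / K); first by rewrite !divr_gt0.
  move=> u v su vt /andP[uc cv] cu vc us; apply: le_trans us.
  apply: (ler_cvg_to (omega_limit_cvg i v) (omega_limit_cvg i u)).
  have hcv : gmup G i (c + q%:R * T) - forces k G X (c + q%:R * T) i @[q --> U] --> h.
    under eq_fun do rewrite gmup_periodicn.
    by apply: cvgB; [exact: cvg_cst|exact: forces_omega_limit].
  have h2 : h / 2 < h by lra.
  have h3 := cvgr_gt _ hcv _ h2; near=> q.
  have uq : t0 - u <= q%:R * T by near: q; exact: near_large.
  have hq : h / 2 < gmup G i (c + q%:R * T) - forces k G X (c + q%:R * T) i by near: q; exact: h3.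
  rewrite lerD2r; apply: mup.
  + by rewrite -lerBlDl.
  + by rewrite lerD2r (le_trans uc).
  + move=> r /andP[ur rv]; rewrite -subr_gt0.
    have := LK r (c + q%:R * T).
    have : K * `|r - (c + q%:R * T)| < h / 2.
      by rewrite mulrC -ltr_pdivlMr// ltr_norml; lra.
    rewrite ler_norml; lra.
- move=> i s t _ st lt_mu.
  apply: (@continuous_induction R s t (fun r => omega_limit i s <= omega_limit i r)) => //.
  move=> c sct.
  have [K K0 LK] := LipD _ _ (Lip_forces k G X i LX) (Lip_gmum G i).
  set h := forces k G omega_limit c i + gmum G i c.
  have h0 : 0 < h by rewrite -ltrBlDr sub0r lt_mu.
  exists (h / 2 / K); first by rewrite !divr_gt0.
  move=> u v su vt /andP[uc cv] cu vc us; apply: (le_trans us).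
  apply: (ler_cvg_to (omega_limit_cvg i u) (omega_limit_cvg i v)).
  have hcv : forces k G X (c + q%:R * T) i + gmum G i (c + q%:R * T) @[q --> U] --> h.
    under eq_fun do rewrite gmum_periodicn.
    by apply: cvgD; [exact: forces_omega_limit|exact: cvg_cst].
  have h2 : h / 2 < h by lra.
  have h3 := cvgr_gt _ hcv _ h2; near=> q.
  have uq : t0 - u <= q%:R * T by near: q; exact: near_large.
  have hq : h / 2 < forces k G X (c + q%:R * T) i + gmum G i (c + q%:R * T) by near: q; exact: h3.
  rewrite lerD2r; apply: mum.
  + by rewrite -lerBlDl.
  + by rewrite lerD2r (le_trans uc).
  + move=> r /andP[ur rv]; rewrite -sub0r ltrBlDr.
    have := LK r (c + q%:R * T).
    have : K * `|r - (c + q%:R * T)| < h / 2.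
      by rewrite mulrC -ltr_pdivlMr// ltr_norml; lra.
    rewrite ler_norml; lra.
Unshelve. all: by end_near. Qed.

Lemma crawling_weaken a b Y : a <= b -> crawling k G a Y -> crawling k G b Y.
Proof.
move=> ab [LY adm mup mum]; split => //.
- by move=> i t bt; apply: adm; exact: le_trans bt.
- by move=> i s t bs; apply: mup; exact: le_trans bs.
- by move=> i s t bs; apply: mum; exact: le_trans bs.
Qed.

(** Spelled as the instance [q = 1], [c = 0] of [crawling_shift]. *)
Definition next_period (Y : 'I_N -> R -> R) i t := Y i (t + 1%:R * T) + 0.

Lemma crawling_next_period a Y : crawling k G a Y -> crawling k G a (next_period Y).
Proof.
move=> cY; apply: (crawling_weaken (a - 1%:R * T)); last exact: crawling_shift.
by rewrite lerBlDr mul1r lerDl ltW.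
Qed.

(** LaSalle's invariance principle: [EX] decreases to its infimum, and its values at t + q T tend
    along [U] to the energy of the limit at [t], whatever [t] is. *)
Lemma omega_limit_energy_cst : exists E, forall t,
  gap_energy (next_period omega_limit) omega_limit t = E.
Proof.
pose EX t := gap_energy (next_period X) X t.
have EX0 t : 0 <= EX t by apply: sumr_ge0 => j _; exact: sqr_ge0.
have EXdec s t : t0 <= s -> s <= t -> EX t <= EX s.
  by apply: (gap_energy_nonincreasing k G k0 t0); first exact: crawling_next_period.
pose S := [set EX t | t in [set t | t0 <= t]].
have infS : has_inf S.
  split; first by exists (EX t0), t0 => /=.
  by exists 0 => _ [t _ <-].
exists (inf S) => t.
have cv1 : EX (t + q%:R * T) @[q --> U] --> inf S.
  apply/cvgrPdist_le => e e0.
  have [_ [s /= ts <-] sS] := inf_adherent e0 infS.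
  near=> q.
  have qs : s - t <= q%:R * T by near: q; exact: near_large.
  rewrite lerBlDl in qs.
  have t0q : t0 <= t + q%:R * T by exact: le_trans qs.
  have h1 : inf S <= EX (t + q%:R * T).
    by apply: ge_inf; [exact: infS.2|exists (t + q%:R * T)].
  have h2 := EXdec _ _ ts qs.
  by rewrite distrC ger0_norm ?subr_ge0//; lra.
have cv2 : EX (t + q%:R * T) @[q --> U] -->
    gap_energy (next_period omega_limit) omega_limit t.
  have E q : EX (t + q%:R * T) = \sum_j gap (fun i =>
      shifted q i (t + 1%:R * T) + 0 - shifted q i t) j ^+ 2.
    apply: eq_bigr => j _; congr (_ ^+ 2); rewrite /next_period /shifted /gap.
    by rewrite ![t + q%:R * T + _]addrAC; ring.
  under eq_fun do rewrite E.
  apply: cvg_fin_sum => j.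
  have cg : gap (fun i => shifted q i (t + 1%:R * T) + 0 - shifted q i t) j @[q --> U] -->
     gap (fun i => next_period omega_limit i t - omega_limit i t) j.
    apply: (cvg_gap _ U (fun i q => shifted q i (t + 1%:R * T) + 0 - shifted q i t)) => i.
    apply: cvgB; last exact: omega_limit_cvg.
    by apply: cvgD; [exact: omega_limit_cvg|exact: cvg_cst].
  by rewrite expr2; under eq_fun do rewrite expr2; exact: cvgM.
exact: cvg_unique cv2 cv1.
Unshelve. all: by end_near. Qed.

Lemma omega_limit_increment : exists c : 'I_N -> R, forall i t,
  omega_limit i (t + T) = omega_limit i t + c i.
Proof.
have [E EE] := omega_limit_energy_cst.
(* The starting time [a] may be any real, so the increments at any two times agree. *)
have D a i t : a <= t -> omega_limit i (t + T) - omega_limit i t =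
    omega_limit i (a + T) - omega_limit i a.
  move=> at_; have c1 := omega_limit_crawling a; have c2 := crawling_next_period _ _ c1.
  have H r : a <= r -> gap_energy (next_period omega_limit) omega_limit r =
      gap_energy (next_period omega_limit) omega_limit a by rewrite !EE.
  have := gap_energy_cst k G k0 a _ _ c2 c1 H i t at_.
  by rewrite /next_period !mul1r !addr0.
exists (fun i => omega_limit i (t0 + T) - omega_limit i t0) => i t.
have [tt|/ltW tt] := leP t t0.
  by rewrite (D _ i _ tt); ring.
by rewrite -(D _ i _ tt); ring.
Qed.

(** Increments that differ between bodies would make the shape grow linearly in [q], against
    [osc_bound] at t0 + q T, which by periodicity is the bound at [t0]. *)
Lemma omega_limit_running : exists v, forall i t q,
  omega_limit i (t + q%:R * T) = omega_limit i t + q%:R * T * v.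
Proof.
have [c cE] := omega_limit_increment.
have cqE i t q : omega_limit i (t + q%:R * T) = omega_limit i t + q%:R * c i.
  elim: q => [|q IH]; first by rewrite !mul0r !addr0.
  by rewrite -natr1 mulrDl mul1r addrA cE IH; ring.
have cc i l : c i = c l.
  have [B BP] := osc_bound k G k0 t0.
  have bound q : `|omega_limit i (t0 + q%:R * T) - omega_limit l (t0 + q%:R * T)| <= B.
    apply: (BP (fun l => omega_limit l (t0 + q%:R * T))) => m.
    have [_ adm _ _] := omega_limit_crawling (t0 + q%:R * T).
    have := adm m _ (lexx _).
    by rewrite /forces force_periodic gmup_periodicn gmum_periodicn.
  apply/eqP; rewrite -subr_eq0; apply/negPn/negP => ncc.
  have p : 0 < `|c i - c l| by rewrite normr_gt0.
  pose q := (Num.truncn ((B + B) / `|c i - c l|)).+1.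
  have := truncnS_gt ((B + B) / `|c i - c l|); rewrite -/q ltr_pdivrMr// => H.
  have := bound q; have := bound 0%N; rewrite !cqE mul0r.
  move=> b0 bq; have : `|q%:R * (c i - c l)| <= B + B.
    by move: b0 bq; rewrite !ler_norml; lra.
  by rewrite normrM ger0_norm// leNgt H.
exists (c i0 / T) => i t q; rewrite cqE (cc i i0); field.
by rewrite gt_eqF.
Qed.

Lemma omega_limit_attracts : exists b, forall e, 0 < e -> exists2 s, t0 <= s &
  forall i t, s <= t -> `|X i t - omega_limit i t - b| <= e.
Proof.
have [v vE] := omega_limit_running.
have cO := omega_limit_crawling t0.
pose M t := topd X omega_limit i0 t; pose m t := - topd omega_limit X i0 t.
have Mdec s t : t0 <= s -> s <= t -> M t <= M s.
  exact: (topd_nonincreasing k G k0 t0 _ _ cX cO).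
have minc s t : t0 <= s -> s <= t -> m s <= m t.
  by move=> ts st; rewrite lerN2; exact: (topd_nonincreasing k G k0 t0 _ _ cO cX).
have dM i t : X i t - omega_limit i t <= M t by exact: (topd_ge X omega_limit i0).
have md i t : m t <= X i t - omega_limit i t.
  by rewrite lerNl opprB; exact: (topd_ge omega_limit X i0).
have mM s t : t0 <= s -> t0 <= t -> m s <= M t.
  move=> ts tt; pose r := Num.max s t.
  have sr : s <= r by rewrite le_max lexx.
  have tr : t <= r by rewrite le_max lexx orbT.
  apply: (le_trans (minc _ _ ts sr)); apply: le_trans (Mdec _ _ tt tr).
  exact: le_trans (md i0 r) (dM i0 r).
pose S := [set M t | t in [set t | t0 <= t]].
have infS : has_inf S.
  split; first by exists (M t0), t0 => /=.
  by exists (m t0) => _ [t tt <-]; exact: mM.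
exists (inf S) => e e0.
(* At t0 + q T, running periodicity makes [X - omega_limit] equal to [shifted q - omega_limit] at
   [t0] up to a constant common to all bodies. One good [q] suffices, as [M - m] does not
   increase. *)
have [s ts osc] : exists2 s, t0 <= s & M s - m s <= e.
  have near_e : \forall q \near U, forall i, `|shifted q i t0 - omega_limit i t0| <= e / 2.
    apply: filter_forall => i; have := omega_limit_cvg i t0.
    have e20 : 0 < e / 2 by rewrite divr_gt0.
    by move=> /cvgrPdist_le/(_ _ e20); apply: filterS => q; rewrite distrC.
  have [q qP] := @filter_ex _ _ PU _ near_e.
  exists (t0 + q%:R * T); first by rewrite lerDl mulr_ge0// ltW.
  have [i iE] := topd_ex X omega_limit i0 (t0 + q%:R * T).
  have [l lE] := topd_ex omega_limit X i0 (t0 + q%:R * T).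
  rewrite /M /m iE lE !vE; have := qP i; have := qP l; rewrite /shifted !ler_norml; lra.
exists s => // i t st; have tt := le_trans ts st.
have h1 : inf S <= M t by apply: ge_inf; [exact: infS.2|exists t].
have h2 : m t <= inf S.
  by apply: lb_le_inf; [exact: infS.1|move=> _ [r tr <-]; exact: mM].
have := Mdec _ _ ts st; have := minc _ _ ts st; have := dM i t; have := md i t.
rewrite ler_norml; lra.
Qed.

End Omega_limit.

(** * Convergence of the velocities *)

Section Small_integral.
Context {d} {S : measurableType d} {R : realType} (mu : {measure set S -> \bar R}).
Variable D : set S.
Hypotheses (mD : measurable D) (Dfin : (mu D < +oo)%E).
Implicit Types (f g : S -> R) (e c : R).

(** The integral is signed and bounded from above only, so that the derivative of a uniformly small
    function qualifies. *)
Definition small_integral e f : Prop :=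
  mu.-integrable D (EFin \o f) /\ \int[mu]_(t in D) f t <= e.

Lemma small_integralD e1 e2 f g : small_integral e1 f -> small_integral e2 g ->
  small_integral (e1 + e2) (fun t => f t + g t).
Proof.
move=> [fi fe] [gi ge]; split; last by rewrite RintegralD// lerD.
rewrite (_ : _ \o _ = (fun t => (f t)%:E + (g t)%:E)%E); last by apply/funext.
exact: integrableD.
Qed.

Lemma small_integralZ c e f : 0 <= c -> small_integral e f ->
  small_integral (c * e) (fun t => c * f t).
Proof.
move=> c0 [fi fe]; split; last by rewrite RintegralZl// ler_wpM2l.
rewrite (_ : _ \o _ = (fun t => c%:E * (f t)%:E)%E); last by apply/funext.
exact: integrableZl.
Qed.

Lemma small_integral_cst c : small_integral (c * fine (mu D)) (fun=> c).
Proof.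
split; last by rewrite Rintegral_cst.
apply: measurable_bounded_integrable => //; exists `|c|; split; first exact: num_real.
by move=> M /ltW cM t _.
Qed.

Lemma small_integral_sum (I : finType) e (f : I -> S -> R) :
  (forall i, small_integral e (f i)) ->
  small_integral (#|I|%:R * e) (fun t => \sum_i f i t).
Proof.
move=> fe.
suff H : forall r : seq I, small_integral ((size r)%:R * e) (fun t => \sum_(i <- r) f i t).
  by have := H (index_enum I); rewrite -[index_enum I]enumT -cardE.
elim=> [|i r IH].
  rewrite (_ : (fun t => \sum_(i <- [::]) f i t) = (fun=> 0)).
    by have := small_integral_cst 0; rewrite /= !mul0r.
  by apply/funext => t; rewrite big_nil.
rewrite (_ : (fun t => \sum_(l <- i :: r) f l t) =
    (fun t => f i t + \sum_(l <- r) f l t)).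
  rewrite /= -natr1 mulrDl mul1r addrC.
  exact: small_integralD.
by apply/funext => t; rewrite big_cons.
Qed.

Lemma cvg0_small_integral (f : nat -> S -> R) (g : S -> R) :
  (forall n, measurable_fun D (f n)) ->
  {ae mu, forall t, D t -> f n t @[n --> \oo] --> 0} ->
  mu.-integrable D (EFin \o g) ->
  (forall n t, D t -> `|f n t| <= g t) ->
  forall e, 0 < e -> \forall n \near \oo, small_integral e (f n).
Proof.
move=> mf f0 gi fg e e0.
have fi n : mu.-integrable D (EFin \o f n).
  apply: le_integrable gi => //; first exact/measurable_EFinP.
  by move=> t Dt /=; rewrite lee_fin (le_trans (fg n t Dt))// ler_norm.
have [||||_ _ cv] := @dominated_convergence _ _ _ mu D mD (fun n => EFin \o f n) (cst 0%E) (EFin \o g) _ _ _ gi.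
- by move=> n; exact/measurable_EFinP.
- exact: measurable_cst.
- move: f0; apply: filterS => t H Dt; apply/cvg_EFin; first exact: nearW.
  exact: H.
- by apply: aeW => t n Dt; rewrite /= lee_fin; exact: fg.
rewrite integral0 in cv.
have : \int[mu]_(t in D) f n t @[n --> \oo] --> (0 : R).
  exact: (@fine_cvg _ _ _ _ _ 0 cv).
move=> /cvgrPdist_le/(_ _ e0).
apply: filterS => n /=; rewrite sub0r normrN => H; split => //.
exact: le_trans (ler_norm _) H.
Qed.

End Small_integral.

Section Lebesgue_small.
Context {R : realType}.
Implicit Types (a b e : R).

Let itv_fin a b : (@lebesgue_measure R `[a, b]%classic < +oo)%E.
Proof. by rewrite lebesgue_measure_itv/=; case: ifP => _; rewrite ?ltry// -EFinB ltry. Qed.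

Lemma continuous_measurable_leb (f : R -> R) (D : set (measurableTypeR R)) :
  continuous f -> @measurable_fun _ _ (measurableTypeR R) _ D f.
Proof. by move=> cf; apply: measurable_funTS; exact: continuous_measurable_fun. Qed.

(** Excluding [f t = 0] makes the indicator vanish eventually at every point; dominated convergence
    concludes. *)
Lemma small_integral_near_boundary (f : R -> R) a b e : continuous f -> 0 < e ->
  \forall n \near \oo, small_integral (@lebesgue_measure R) `[a, b]%classic e
    (fun t => if (0 < f t) && (f t <= n.+1%:R^-1) then 1 else 0).
Proof.
move=> cf e0.
have mI : measurable (`[a, b]%classic : set (measurableTypeR R)) by exact: measurable_itv.
apply: (cvg0_small_integral _ _ mI _ (fun=> 1)) => //.
- move=> n; have mf := continuous_measurable_leb f `[a, b]%classic cf.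
  apply: measurable_fun_if => //.
  apply: measurable_and.
    by apply: measurable_fun_ltr => //; exact: measurable_cst.
  by apply: measurable_fun_ler => //; exact: measurable_cst.
- apply: aeW => t _; have [ft|ft] := leP (f t) 0.
    by apply: cvg_near_cst; apply: nearW.
  apply: cvg_near_cst.
  exists (Num.truncn (f t)^-1) => // n /= tn.
  rewrite /= leNgt (_ : n.+1%:R^-1 < f t)//.
  rewrite invf_plt ?posrE//; apply: lt_le_trans (truncnS_gt _) _.
  by rewrite ler_nat.
- by have [] := small_integral_cst _ _ mI (itv_fin a b) (1 : R).
- by move=> n t _; case: ifP => _; rewrite ?normr1 ?normr0.
Qed.

Lemma small_integral_difference_quotient (H h : R -> R) (K a b e : R) :
  0 < K -> lip R K H ->
  (@lebesgue_measure R).-integrable `[a, b]%classic (EFin \o h) ->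
  {ae lebesgue_measure, forall t, a < t < b -> derivable H t 1 /\ derive1 H t = h t} ->
  0 < e ->
  \forall n \near \oo, small_integral (@lebesgue_measure R) `[a, b]%classic e
    (fun t => `|n.+1%:R * (H (t + n.+1%:R^-1) - H t) - h t|).
Proof.
move=> K0 LH hi dH e0.
have mI : measurable (`[a, b]%classic : set (measurableTypeR R)) by exact: measurable_itv.
have cH : continuous H by apply: Lip_continuous; exists K.
have mh := measurable_int _ hi.
apply: (cvg0_small_integral _ _ mI _ (fun t => K + `|h t|)) => //.
- move=> n; apply: measurableT_comp => //; apply: measurable_funB; last exact/measurable_EFinP.
  apply: continuous_measurable_leb => t; apply: cvgM; first exact: cvg_cst.
  apply: cvgB; last exact: cH.
  by apply: (@cvg_comp _ _ _ (fun t => t + n.+1%:R^-1) H); [|exact: cH]; apply: cvgD; [exact: cvg_id|exact: cvg_cst].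
- have aeab : {ae lebesgue_measure, forall t : R, t != a /\ t != b}.
    exists [set a; b]; split.
    + by apply: measurableU; exact: measurable_set1.
    + by apply: countable_lebesgue_measure0; apply: finite_set_countable.
    + move=> t /= /not_andP[] /negP; rewrite negbK => /eqP ->; by [left|right].
  have := ae_conj _ _ aeab dH; apply: ae_mono => t [[ta tb] dHt].
  rewrite /= in_itv/= => /andP[at_ t_b].
  have [|dt <-] := dHt; first by rewrite !lt_neqAle at_ t_b tb eq_sym ta.
  apply/cvgrPdist_le => r r0.
  have [d d0 dP] := derivable_approx _ _ _ dt _ r0.
  exists (Num.truncn d^-1).+1 => // n /= dn.
  have n0 : (0 : R) < n.+1%:R by rewrite ltr0n.
  have nd : n.+1%:R^-1 < d.
    rewrite invf_plt ?posrE//; apply: lt_le_trans (truncnS_gt _) _.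
    by rewrite ler_nat ltnW.
  have := dP (t + n.+1%:R^-1); rewrite addrAC subrr add0r gtr0_norm ?invr_gt0// => /(_ nd) Hd.
  rewrite sub0r normrN normr_id.
  have -> : n.+1%:R * (H (t + n.+1%:R^-1) - H t) - derive1 H t =
      n.+1%:R * (H (t + n.+1%:R^-1) - H t - derive1 H t * n.+1%:R^-1).
    by field; rewrite gt_eqF// pnatr_eq0.
  rewrite normrM gtr0_norm// -ler_pdivlMl// [leRHS]mulrC.
  exact: Hd.
- have [c1 _] := small_integral_cst _ _ mI (itv_fin a b) K.
  rewrite (_ : _ \o _ = (fun t => K%:E + `|(h t)%:E|)%E); last by apply/funext.
  by apply: integrableD => //; exact: integrable_abse.
- move=> n t _; rewrite normr_id; apply: (le_trans (ler_normB _ _)); rewrite lerD2r.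
  rewrite normrM ger0_norm//.
  have := LH (t + n.+1%:R^-1) t.
  rewrite [X in K * `|X|]addrAC subrr add0r [`|_^-1|]ger0_norm ?invr_ge0// => HL.
  by rewrite [leLHS]mulrC -ler_pdivlMr ?ltr0n.
Qed.

End Lebesgue_small.

(** Clamping the argument to the interval gives a function that is Lipschitz on the whole line. *)
Lemma lip_in_density (R : realType) (f : R -> R) (K a b : R) :
  a < b -> lip_in R a b K f ->
  exists h : R -> R, [/\ lebesgue_measure.-integrable `[a, b] (EFin \o h),
    {ae lebesgue_measure, forall t, a < t < b ->
       derivable f t 1 /\ derive1 f t = h t} &
    f b - f a = \int[lebesgue_measure]_(y in `[a, b]) h y].
Proof.
move=> ab Lf; pose c t := Num.max a (Num.min t b).
have ac t : a <= c t by rewrite le_max lexx.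
have cb t : c t <= b by rewrite ge_max (ltW ab) ge_min lexx orbT.
have cE t : a <= t -> t <= b -> c t = t.
  by move=> at_ tb; rewrite /c min_l// max_r.
have K0 : 0 <= K.
  have := Lf a b (lexx _) (ltW ab) (lexx _).
  by move=> /(le_trans (normr_ge0 _)); rewrite pmulr_lge0// subr_gt0.
have c_cases t : [\/ t <= a /\ c t = a, [/\ a <= t, t <= b & c t = t] | b <= t /\ c t = b].
  have [ta|/ltW ta] := leP t a.
    by constructor 1; rewrite /c min_l ?(le_trans ta) ?ltW// max_l.
  have [tb|/ltW bt] := leP t b; first by constructor 2; rewrite cE.
  by constructor 3; rewrite /c min_r// max_r// ltW.
have Lc s t : s <= t -> c t - c s <= t - s /\ c s <= c t.
  move=> st.
  by have [[s1 ->]|[s1 s2 ->]|[s1 ->]] := c_cases s;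
    have [[r1 ->]|[r1 r2 ->]|[r1 ->]] := c_cases t; split; lra.
have Lfc : lip R K (fun t => f (c t)).
  move=> s t; wlog st : s t / s <= t.
    by move=> H; have [/H//|/ltW/H] := leP s t; rewrite distrC [`|t - s|]distrC.
  have [c1 c2] := Lc _ _ st.
  rewrite distrC (le_trans (Lf _ _ (ac s) c2 (cb t)))// ler_wpM2l//.
  by rewrite distrC ger0_norm ?subr_ge0.
have [h [hi dh hE]] := lip_density _ _ _ _ _ ab Lfc.
exists h; split => //; last first.
  by rewrite -hE !cE ?lexx ?ltW.
move: dh; apply: ae_mono => t H tab; have [df <-] := H tab.
have nE : \near t, f (c t) = f t.
  near=> s; have : s \in `]a, b[ by near: s; apply: near_in_itvoo; rewrite in_itv.
  by rewrite in_itv/= => /andP[/ltW as_ /ltW sb]; rewrite cE.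
have D := near_eq_is_derive nE (is_derive1P _ _ df).
by split; [exact: (is_derive1_derivable _ _ _ D)|exact: (is_derive1E _ _ _ D)].
Unshelve. all: by end_near. Qed.

Lemma lip_in_mul (R : realType) (f g : R -> R) (a b : R) : Lip f -> Lip g ->
  exists K, lip_in R a b K (fun t => f t * g t).
Proof.
(* Polarization: the product is a quarter of the difference of the squares of the sum and of the
   difference. *)
move=> Lf Lg; have [K1 L1] := Lip_sqr_in _ _ a b (LipD _ _ Lf Lg).
have [K2 L2] := Lip_sqr_in _ _ a b (LipB _ _ Lf Lg).
exists ((K1 + K2) / 4) => s t as_ st tb.
have := L1 s t as_ st tb; have := L2 s t as_ st tb; rewrite !ler_norml.
move=> /andP[h1 h2] /andP[h3 h4]; apply/andP; split; lra.
Qed.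

Lemma small_integral_le d (S : measurableType d) (R : realType)
    (mu : {measure set S -> \bar R}) (D : set S) (e e' : R) (f : S -> R) :
  e <= e' -> small_integral mu D e f -> small_integral mu D e' f.
Proof. by move=> ee' [fi fe]; split => //; exact: le_trans ee'. Qed.

(** * Velocities of two nearby motions *)

Section Derivative_gap.
Context {R : realType} {N : nat} {T : R} (k : R) (G : gait N T).
Hypotheses (k0 : 0 < k).
Variables (t0 t1 K : R) (Z : 'I_N -> R -> R).
Hypotheses (t01 : t0 < t1) (K0 : 0 < K).
Hypotheses (cZ : crawling k G t0 Z) (LZ : forall i, lip R K (Z i)).

Let leb := @lebesgue_measure R.
Let H j t : R := gap (fun i => Z i t) j.
Let Hn n j t : R := n.+1%:R * (H j (t + n.+1%:R^-1) - H j t).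
Let slackp i t : R := gmup G i t - forces k G Z t i.
Let slackm i t : R := forces k G Z t i + gmum G i t.
(* Indicates the bounds that the forces of [Z] approach without reaching them.
   When it vanishes, a body moving in a nearby motion [Y] has the same force in
   [Y] and in [Z], so that [lap (Y - Z)] and its derivative vanish. *)
Let bdry n i t : R :=
  (if (0 < slackp i t) && (slackp i t <= n.+1%:R^-1) then 1 else 0) +
  (if (0 < slackm i t) && (slackm i t <= n.+1%:R^-1) then 1 else 0).

Let lip_H j : lip R (2 * K) (H j).
Proof.
move=> s t; have := LZ (ord_next j) s t; have := LZ (ord_this j) s t.
rewrite /H /gap !ler_norml; lra.
Qed.

Let lip_Hn n j : lip R (n.+1%:R * (4 * K)) (Hn n j).
Proof.
move=> s t; rewrite /Hn -mulrBr normrM ger0_norm// -mulrA ler_wpM2l//.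
have := lip_H j (s + n.+1%:R^-1) (t + n.+1%:R^-1); have := lip_H j s t.
rewrite (_ : s + n.+1%:R^-1 - (t + n.+1%:R^-1) = s - t); last by ring.
rewrite !ler_norml; lra.
Qed.

Let Hn_bound n j t : `|Hn n j t| <= 2 * K.
Proof.
rewrite /Hn normrM ger0_norm// [leLHS]mulrC -ler_pdivlMr ?ltr0n//.
apply: (le_trans (lip_H _ _ _)).
by rewrite (_ : t + n.+1%:R^-1 - t = n.+1%:R^-1) ?ger0_norm ?invr_ge0//; ring.
Qed.

Let Lip_slackp i : Lip (slackp i).
Proof. by have [L _ _ _] := cZ; apply: LipB; [exact: Lip_gmup|exact: Lip_forces]. Qed.

Let Lip_slackm i : Lip (slackm i).
Proof. by have [L _ _ _] := cZ; apply: LipD; [exact: Lip_forces|exact: Lip_gmum]. Qed.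

Let bdry_ge0 n i t : 0 <= bdry n i t.
Proof. by rewrite /bdry; do 2!case: ifP. Qed.

(** A moving body of [Y] has its force at a friction bound, and the force of [Z] is within 1/(n+1)
    of it. Either [Z] is at the same bound, the forces agree and [lap (u - w)] vanishes, or [bdry]
    is at least 1 and the crude bound on the product applies. *)
Lemma work_bound n eps (Y : 'I_N -> R -> R) t u w i :
  k * (N%:R * (2 * eps)) <= n.+1%:R^-1 -> 0 <= eps -> t0 <= t ->
  (forall i, `|Y i t - Z i t| <= eps) ->
  `|u i| <= K -> (forall l, `|u l - w l| <= 2 * K) ->
  (forall i, friction_incl G t i (u i) (forces k G Y t i)) ->
  (lap (fun l => Y l t - Z l t) i = 0 -> lap (fun l => u l - w l) i = 0) ->
  u i * lap (fun l => u l - w l) i <= K * (N%:R * (2 * (2 * K))) * bdry n i t.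
Proof.
move=> epsn eps0 tt YZ uK vK incl lap0.
have [_ /(_ i _ tt)/andP[zlo zhi] _ _] := cZ.
have lapv : `|lap (fun l => u l - w l) i| <= N%:R * (2 * (2 * K)).
  by apply: lap_bound => //; rewrite mulr_ge0// ltW.
have ulap : u i * lap (fun l => u l - w l) i <= K * (N%:R * (2 * (2 * K))).
  by rewrite (le_trans (ler_norm _))// normrM ler_pM.
have C0 : 0 <= K * (N%:R * (2 * (2 * K))).
  by rewrite !mulr_ge0// ltW.
have lapd := lap_bound _ _ i eps0 YZ.
have fd := forceB k G t (fun l => Y l t) (fun l => Z l t) i.
have fdn : `|forces k G Y t i - forces k G Z t i| <= n.+1%:R^-1.
  rewrite /forces fd normrN normrM gtr0_norm//; apply: le_trans epsn.
  by rewrite ler_pM2l.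
have feq : forces k G Y t i = forces k G Z t i -> lap (fun l => u l - w l) i = 0.
  move=> fE; apply: lap0; move: fd; rewrite -/(forces k G Y t i) -/(forces k G Z t i) fE subrr.
  by move=> /esym/eqP; rewrite oppr_eq0 mulf_eq0 gt_eqF//= => /eqP.
have [_ up un] := incl i.
have Cb (x y : R) : 0 <= y -> x = 1 ->
    u i * lap (fun l => u l - w l) i <= K * (N%:R * (2 * (2 * K))) * (x + y).
  move=> y0 ->; apply: (le_trans ulap); rewrite -[leLHS]mulr1 ler_wpM2l//.
  by rewrite lerDl.
have [u0|u0|->] := ltgtP (u i) 0; last by rewrite mul0r mulr_ge0// bdry_ge0.
- have fm := un u0; have [sm|sm] := ltP 0 (slackm i t); last first.
    rewrite feq; first by rewrite mulr0 mulr_ge0// bdry_ge0.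
    by rewrite fm; move: sm zlo; rewrite /slackm; lra.
  rewrite /bdry addrC; apply: Cb; first by case: ifP.
  by rewrite sm/= ifT// /slackm; move: fdn; rewrite fm ler_norml lerNl opprB opprK => /andP[].
- have fp := up u0; have [sp|sp] := ltP 0 (slackp i t); last first.
    rewrite feq; first by rewrite mulr0 mulr_ge0// bdry_ge0.
    by rewrite fp; move: sp zhi; rewrite /slackp; lra.
  rewrite /bdry; apply: Cb; first by case: ifP.
  by rewrite sp/= ifT// /slackp; move: fdn; rewrite fp ler_norml => /andP[].
Qed.

(* With u, z the velocities of [Y], [Z] and v = u - z, the sum of u_i (lap v)_i is
   nearly zero by [work_bound], so |D v|^2 is nearly - (D z).(D v). Replacing D z
   by the difference quotients [Hn] turns this into the derivative of [Phi], up to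
   a multiple of the distance [eps] of [Y] and [Z]. *)
Lemma derivative_gap_small e : 0 < e -> exists2 eps, 0 < eps &
  forall Y : 'I_N -> R -> R, crawling k G t0 Y -> (forall i, lip R K (Y i)) ->
    (forall i t, t0 <= t -> `|Y i t - Z i t| <= eps) ->
    exists2 rho : R -> R, small_integral leb `[t0, t1]%classic e rho &
      {ae lebesgue_measure, forall t, t0 < t < t1 -> exists w,
        (forall i, is_derive t 1 (fun s => Y i s - Z i s) (w i)) /\
        \sum_i ((Y i t - Z i t) ^+ 2 + w i ^+ 2) <= rho t}.
Proof.
move=> e0; pose C := K * (N%:R * (2 * (2 * K))).
have C0 : 0 <= C by rewrite !mulr_ge0// ltW.
pose M2 := 4 * N%:R ^+ 2 * (C * (N%:R * 2) + 4 * K * N%:R) : R.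
have M20 : 0 <= M2.
  by rewrite mulr_ge0 ?addr_ge0 ?mulr_ge0 ?exprn_ge0 ?(ltW K0).
(* [M2] collects the coefficients in [rho] of the integrals that [n] makes small; they get half of
   [e]. *)
pose eta := e / (2 * (M2 + 1)).
have eta0 : 0 < eta by rewrite divr_gt0// mulr_gt0// ltr_wpDl.
have /(_ _)/cid-/all_sig[h hP] : forall j, exists h : R -> R,
    leb.-integrable `[t0, t1] (EFin \o h) /\
    {ae lebesgue_measure, forall t, t0 < t < t1 -> derivable (H j) t 1 /\ derive1 (H j) t = h t}.
  by move=> j; have [h [? ? _]] := lip_density _ _ _ _ _ t01 (lip_H j); exists h.
have [n [np [nm nq]]] : exists n, (forall i, small_integral leb `[t0, t1]%classic eta
      (fun t => if (0 < slackp i t) && (slackp i t <= n.+1%:R^-1) then 1 else 0)) /\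
    (forall i, small_integral leb `[t0, t1]%classic eta
      (fun t => if (0 < slackm i t) && (slackm i t <= n.+1%:R^-1) then 1 else 0)) /\
    (forall j, small_integral leb `[t0, t1]%classic eta (fun t => `|Hn n j t - h j t|)).
  have K20 : 0 < 2 * K by rewrite mulr_gt0.
  have F1 : \forall n \near \oo, forall i, small_integral leb `[t0, t1]%classic eta
      (fun t => if (0 < slackp i t) && (slackp i t <= n.+1%:R^-1) then 1 else 0).
    apply: filter_forall => i; apply: small_integral_near_boundary => //.
    exact/Lip_continuous/Lip_slackp.
  have F2 : \forall n \near \oo, forall i, small_integral leb `[t0, t1]%classic eta
      (fun t => if (0 < slackm i t) && (slackm i t <= n.+1%:R^-1) then 1 else 0).
    apply: filter_forall => i; apply: small_integral_near_boundary => //.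
    exact/Lip_continuous/Lip_slackm.
  have F3 : \forall n \near \oo, forall j,
      small_integral leb `[t0, t1]%classic eta (fun t => `|Hn n j t - h j t|).
    apply: filter_forall => j; have [hi dh] := hP j.
    exact: (small_integral_difference_quotient (H j) (h j) (2 * K)).
  near \oo => n; exists n; split; first by near: n.
  by split; near: n.
have [L L0 muL] : exists2 L, 0 < L & fine (leb `[t0, t1]%classic) = L.
  exists (t1 - t0); first by rewrite subr_gt0.
  by rewrite /leb lebesgue_measure_itv/= lte_fin t01.
(* [M] collects the terms of [rho] that are small with [eps], among them [c], which contains the
   Lipschitz constant of [Hn] and hence [n]. Requiring [eps <= 1] lets [eps ^+ 2] be counted as
   [eps]. *)
pose M := N%:R * L + 4 * N%:R ^+ 2 * (8 * (N%:R * K) + 8 * N%:R * (n.+1%:R * K) * L) : R.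
have M0 : 0 <= M.
  by rewrite /M; do ![apply: addr_ge0 | apply: mulr_ge0 | apply: exprn_ge0] => //; exact: ltW.
pose eps := Num.min 1 (Num.min (n.+1%:R^-1 / (2 * k * N%:R + 1)) (e / (2 * (M + 1)))).
have kN0 : 0 < 2 * k * N%:R + 1 by rewrite ltr_wpDl// mulr_ge0// mulr_ge0// ltW.
have eps0 : 0 < eps.
  rewrite !lt_min ltr01/=; apply/andP; split; apply: divr_gt0 => //.
  by rewrite mulr_gt0// ltr_wpDl.
exists eps => // Y cY LY YZ.
have eps1 : eps <= 1 by rewrite ge_min lexx.
have epsn : k * (N%:R * (2 * eps)) <= n.+1%:R^-1.
  have : eps <= n.+1%:R^-1 / (2 * k * N%:R + 1) by rewrite !ge_min lexx !orbT.
  rewrite ler_pdivlMr// => H1; apply: le_trans H1.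
  have -> : eps * (2 * k * N%:R + 1) = k * (N%:R * (2 * eps)) + eps by ring.
  by rewrite lerDl ltW.
have epsM : eps * M <= e / 2.
  have : eps <= e / (2 * (M + 1)) by rewrite !ge_min lexx !orbT.
  rewrite invfM mulrA ler_pdivlMr ?ltr_wpDl// mulrDr mulr1 => H1.
  by apply: le_trans H1; rewrite lerDl ltW.
pose D j t : R := gap (fun i => Y i t - Z i t) j.
(* [Hn] is bounded independently of [n], so [Phi] is of order [eps], and so is the integral of its
   derivative [psi]. *)
pose Phi t := - \sum_j Hn n j t * D j t.
have [LipY _ _ _] := cY; have [LipZ _ _ _] := cZ.
have LipD j : Lip (D j) by apply: LipB; apply: LipB.
have LipHn j : Lip (Hn n j) by apply: lip_Lip; exact: lip_Hn.
have [KP LP] : exists KP, lip_in R t0 t1 KP Phi.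
  have [KP LP] := lip_in_sum _ _ (fun j t => Hn n j t * D j t) t0 t1
    (fun j => lip_in_mul _ _ _ t0 t1 (LipHn j) (LipD j)).
  by exists KP => s t h1 h2 h3; rewrite /Phi -opprD normrN; exact: LP.
have [psi [psii dPhi psiE]] := lip_in_density _ _ _ _ _ t01 LP.
have Dbound j t : t0 <= t -> `|D j t| <= 2 * eps.
  move=> tt; have := YZ (ord_next j) t tt; have := YZ (ord_this j) t tt.
  rewrite /D /gap !ler_norml; lra.
have cardN1 : #|{: 'I_N.-1}|%:R <= N%:R :> R by rewrite card_ord ler_nat leq_pred.
have sum_le (f : 'I_N.-1 -> R) B : 0 <= B -> (forall j, f j <= B) -> \sum_j f j <= N%:R * B.
  move=> B0 fB; apply: (@le_trans _ _ (\sum_(j < N.-1) B)); first exact: ler_sum.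
  by rewrite sumr_const card_ord -[X in X <= _]mulr_natl ler_wpM2r// ler_nat leq_pred.
have Phi_bound t : t0 <= t -> `|Phi t| <= N%:R * (2 * K * (2 * eps)).
  move=> tt; rewrite /Phi normrN; apply: (le_trans (ler_norm_sum _ _ _)).
  apply: sum_le => [|j]; first by rewrite !mulr_ge0// ltW.
  by rewrite normrM ler_pM// Dbound.
pose c := N%:R * (2 * eps * (n.+1%:R * (4 * K))).
(* The first term bounds the squared positions. The factor 4 N^2 passes from |D v|^2 to the sum of
   the squared velocities: each is at most 4 [gapsum v ^+ 2], hence at most 4 N |D v|^2. *)
pose rho t := N%:R * eps ^+ 2 + 4 * N%:R ^+ 2 *
  (C * (\sum_i bdry n i t) + (4 * K * (\sum_j `|Hn n j t - h j t|) + (psi t + c))).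
exists rho.
  have Psmall : small_integral leb `[t0, t1]%classic (8 * (N%:R * K) * eps) psi.
    split => //; rewrite -psiE.
    have := Phi_bound t0 (lexx _); have := Phi_bound t1 (ltW t01).
    rewrite !ler_norml; lra.
  have mI : measurable (`[t0, t1]%classic : set (measurableTypeR R)) by exact: measurable_itv.
  have fI : (leb `[t0, t1]%classic < +oo)%E.
    by rewrite /leb lebesgue_measure_itv/= lte_fin t01 -EFinB ltry.
  have cst x : small_integral leb `[t0, t1]%classic (x * L) (fun=> x).
    by have := small_integral_cst leb _ mI fI x; rewrite muL.
  have S1 := small_integral_sum leb _ mI fI 'I_N _ _
    (fun i => small_integralD leb _ mI _ _ _ _ (np i) (nm i)).
  have S2 := small_integral_sum leb _ mI fI 'I_N.-1 _ _ nq.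
  have K40 : 0 <= 4 * K by rewrite mulr_ge0// ltW.
  have S3 := small_integralD leb _ mI _ _ _ _ (small_integralZ leb _ mI _ _ _ C0 S1)
    (small_integralD leb _ mI _ _ _ _ (small_integralZ leb _ mI _ _ _ K40 S2)
      (small_integralD leb _ mI _ _ _ _ Psmall (cst c))).
  have N40 : 0 <= 4 * N%:R ^+ 2 :> R by rewrite mulr_ge0// exprn_ge0.
  have S4 := small_integralD leb _ mI _ _ _ _ (cst (N%:R * eps ^+ 2))
    (small_integralZ leb _ mI _ _ _ N40 S3).
  apply: small_integral_le S4; rewrite !card_ord.
  have etaM : M2 * eta <= e / 2.
    have : eta <= e / (2 * (M2 + 1)) by [].
    rewrite [M2 * _]mulrC invfM mulrA ler_pdivlMr ?ltr_wpDl// mulrDr mulr1 => H1.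
    by apply: le_trans H1; rewrite lerDl ltW.
  have eps2 : N%:R * eps ^+ 2 * L <= N%:R * eps * L.
    by rewrite ler_pM2r// ler_wpM2l// expr2 -[leRHS]mulr1 ler_pM2l.
  have N1 : 4 * K * (N.-1%:R * eta) <= 4 * K * (N%:R * eta).
    by rewrite ler_wpM2l// ler_pM2r// ler_nat leq_pred.
  rewrite [leRHS]splitr; apply: le_trans (lerD etaM epsM).
  apply: (@le_trans _ _ (N%:R * eps * L + 4 * N%:R ^+ 2 *
      (C * (N%:R * (eta + eta)) + (4 * K * (N%:R * eta) + (8 * (N%:R * K) * eps + c * L))))).
    by apply: lerD => //; rewrite ler_wpM2l// lerD2l lerD2r.
  by rewrite le_eqVlt; apply/orP; left; apply/eqP; rewrite /M2 /M /c; ring.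
have aeHn : {ae lebesgue_measure, forall t, forall j, derivable (Hn n j) t 1}.
  by apply: ae_forall_fin => j; exact: ae_derivable.
have aeh : {ae lebesgue_measure, forall t, forall j, t0 < t < t1 ->
    derivable (H j) t 1 /\ derive1 (H j) t = h j t}.
  by apply: ae_forall_fin => j; exact: (hP j).2.
have := ae_conj _ _ (ae_conj _ _ aeHn aeh) (ae_conj _ _ dPhi (ae_regular_pair k G k0 t0 Y Z cY cZ)).
apply: ae_mono => t [[dHn dh] [dP reg]] tt1.
have /andP[t0t _] := tt1; have tt := ltW t0t.
have [u [z [dY inclY dZ inclZ [dv lap_le drift _ lap0]]]] := reg tt.
exists (fun i => u i - z i); split=> //.
set v := fun i => u i - z i.
have uK i : `|u i| <= K.
  by rewrite -(is_derive1E _ _ _ (dY i)); apply: lip_derive_le => //; exact: is_derive1_derivable (dY i).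
have zK i : `|z i| <= K.
  by rewrite -(is_derive1E _ _ _ (dZ i)); apply: lip_derive_le => //; exact: is_derive1_derivable (dZ i).
have vK i : `|v i| <= 2 * K.
  by have := uK i; have := zK i; rewrite /v !ler_norml; lra.
have gvK j : `|gap v j| <= 4 * K.
  by have := vK (ord_next j); have := vK (ord_this j); rewrite /gap !ler_norml; lra.
have hz j : h j t = gap z j.
  have [_ <-] := dh j tt1; apply: is_derive1E.
  by apply: is_derive1B.
have dD j : is_derive t 1 (D j) (gap v j) by apply: is_derive1B; exact: dv.
have psiEt : psi t = - \sum_j (Hn n j t * gap v j + D j t * derive1 (Hn n j) t).
  have [_ <-] := dP tt1; apply: is_derive1E; rewrite -mulN1r.
  have S : is_derive t 1 (fun s => \sum_j Hn n j s * D j s)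
      (\sum_j (Hn n j t * gap v j + D j t * derive1 (Hn n j) t)).
    apply: (is_derive1_sum _ (fun j s => Hn n j s * D j s)) => j.
    by apply: is_derive1M => //; exact: is_derive1P.
  have := is_derive1Z (-1) _ _ _ S; congr is_derive; apply/funext => s.
  by rewrite mulN1r.
have cross : - (\sum_j gap z j * gap v j) <=
    4 * K * (\sum_j `|Hn n j t - h j t|) + (psi t + c).
  have B1 : \sum_j D j t * derive1 (Hn n j) t <= c.
    apply: sum_le => [|j]; first by rewrite !mulr_ge0// ltW.
    rewrite (le_trans (ler_norm _))// normrM ler_pM ?Dbound//.
    exact: lip_derive_le.
  have B2 : \sum_j (Hn n j t - h j t) * gap v j <= 4 * K * (\sum_j `|Hn n j t - h j t|).
    rewrite mulr_sumr; apply: ler_sum => j _.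
    by rewrite (le_trans (ler_norm _))// normrM mulrC ler_wpM2r.
  rewrite psiEt big_split/=.
  have -> : \sum_j gap z j * gap v j = \sum_j Hn n j t * gap v j - \sum_j (Hn n j t - h j t) * gap v j.
    by rewrite -sumrB; apply: eq_bigr => j _; rewrite hz; ring.
  lra.
have gap_sq : \sum_j gap v j ^+ 2 <=
    C * (\sum_i bdry n i t) + (4 * K * (\sum_j `|Hn n j t - h j t|) + (psi t + c)).
  rewrite -lap_dotxx.
  have -> : \sum_i v i * lap v i = \sum_i u i * lap v i - \sum_j gap z j * gap v j.
    rewrite -[X in _ - X](eq_bigr _ (fun j _ => mulrC (gap v j) (gap z j))).
    by rewrite -lap_dot -sumrB; apply: eq_bigr => i _; rewrite -mulrBl.
  have W : \sum_i u i * lap v i <= C * (\sum_i bdry n i t).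
    rewrite mulr_sumr; apply: ler_sum => i _.
    by apply: (work_bound n eps Y t u z i) => //; [exact: ltW|move=> l; exact: YZ|exact: lap0].
  lra.
rewrite /rho big_split/=; apply: lerD.
  apply: (@le_trans _ _ (\sum_(i < N) eps ^+ 2)); last first.
    by rewrite sumr_const card_ord -[X in X <= _]mulr_natl.
  apply: ler_sum => i _; rewrite -[X in X <= _]real_normK ?num_real//.
  by rewrite lerXn2r ?nnegrE ?(ltW eps0)// YZ.
have N40 : 0 <= 4 * N%:R ^+ 2 :> R by rewrite mulr_ge0// exprn_ge0.
apply: le_trans (ler_wpM2l N40 gap_sq).
apply: (@le_trans _ _ (\sum_(i < N) (gapsum v *+ 2) ^+ 2)).
  apply: ler_sum => i _; rewrite -[X in X <= _]real_normK ?num_real//.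
  by rewrite lerXn2r ?nnegrE ?drift// mulrn_wge0// gapsum_ge0.
rewrite sumr_const card_ord -[X in X <= _]mulr_natl.
have := gapsum_sqr v => gs.
have -> : N%:R * (gapsum v *+ 2) ^+ 2 = 4 * N%:R * gapsum v ^+ 2 by rewrite mulr2n; ring.
have -> : 4 * N%:R ^+ 2 * (\sum_j gap v j ^+ 2) = 4 * N%:R * (N%:R * \sum_j gap v j ^+ 2) by ring.
by rewrite ler_wpM2l// mulr_ge0.
Unshelve. all: by end_near. Qed.

End Derivative_gap.

(** * Asymptotic velocity *)

Section Asymptotics.
Context {R : realType} {N : nat} {T : R} (k : R) (G : gait N T).
Hypotheses (k0 : 0 < k) (T0 : 0 < T).
Variables (t0 : R) (i0 : 'I_N).
Implicit Types X Z : 'I_N -> R -> R.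

Definition relative_periodic Z v := forall i t (q : nat),
  Z i (t + q%:R * T) = Z i t + q%:R * T * v.

Definition attracted X Z := forall e : R, 0 < e -> exists2 s, t0 <= s &
  forall i t, s <= t -> `|X i t - Z i t| <= e.

Lemma crawling_attractor X : crawling k G t0 X -> exists Z v,
  [/\ crawling k G t0 Z, relative_periodic Z v & attracted X Z].
Proof.
move=> cX.
have [U [UU Uoo]] := ultraFilterLemma eventually_filter.
pose W := omega_limit k G k0 T0 t0 X i0 cX U UU.
have [v vE] := omega_limit_running k G k0 T0 t0 X i0 cX U UU Uoo.
have [b bP] := omega_limit_attracts k G k0 T0 t0 X i0 cX U UU Uoo.
(* The limit of [X - W] is absorbed into the attractor, written as a trivial shift to fit
   [crawling_shift]. *)
exists (fun i t => W i (t + 0%:R * T) + b), v; split.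
- have := crawling_shift k G _ _ 0 b (omega_limit_crawling k G k0 T0 t0 X i0 cX U UU Uoo t0).
  by rewrite mul0r subr0.
- by move=> i t q; rewrite mul0r !addr0 /W vE addrAC.
- move=> e e0; have [s ts sP] := bP e e0; exists s => // i t st.
  by rewrite mul0r addr0 opprD addrA; exact: sP.
Qed.

(** Bounded distance from a uniform motion is stronger than convergence of the averages and passes
    to any motion at bounded distance. *)
Definition has_velocity X v := exists B s, forall i t, s <= t ->
  `|X i t - (t - t0) * v| <= B.

Lemma relative_periodic_velocity Z v : (forall i, Lip (Z i)) ->
  relative_periodic Z v -> has_velocity Z v.
Proof.
move=> /Lip_uniform[K K0 LK] ZE.
exists (\sum_i `|Z i t0| + K * T + T * `|v|), t0 => i t tt.
pose q := Num.truncn ((t - t0) / T); pose r := t - q%:R * T.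
have qT : q%:R * T <= t - t0 < q.+1%:R * T.
  rewrite -ler_pdivlMr// -ltr_pdivrMr//; apply: truncn_itv.
  by rewrite divr_ge0 ?subr_ge0// ltW.
have r0 : 0 <= r - t0 <= T.
  by case/andP: qT; rewrite -natr1 mulrDl mul1r /r => h1 h2; apply/andP; split; lra.
have -> : Z i t = Z i r + q%:R * T * v by rewrite -ZE /r subrK.
have -> : Z i r + q%:R * T * v - (t - t0) * v = Z i t0 + (Z i r - Z i t0) - (r - t0) * v.
  by rewrite /r; ring.
apply: (le_trans (ler_normB _ _)); apply: lerD.
  apply: (le_trans (ler_normD _ _)); apply: lerD.
    by rewrite (bigD1 i)//= lerDl sumr_ge0.
  apply: (le_trans (LK _ _ _)); rewrite ler_pM2l// ger0_norm; by case/andP: r0.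
by rewrite normrM ler_wpM2r// ger0_norm; case/andP: r0.
Qed.

Lemma attracted_velocity X Z v : attracted X Z -> has_velocity Z v -> has_velocity X v.
Proof.
move=> /(_ 1 ltr01)[s ts XZ] [B [s' ZB]].
exists (1 + B), (Num.max s s') => i t; rewrite ge_max => /andP[st s't].
have -> : X i t - (t - t0) * v = (X i t - Z i t) + (Z i t - (t - t0) * v) by ring.
by rewrite (le_trans (ler_normD _ _))// lerD ?XZ ?ZB.
Qed.

Lemma linear_bounded_eq0 (a B s : R) :
  (forall t, s <= t -> `|(t - t0) * a| <= B) -> a = 0.
Proof.
move=> H; apply/eqP/negPn/negP => a0; have p : 0 < `|a| by rewrite normr_gt0.
pose t := Num.max s (t0 + (`|B| + 1) / `|a|).
have := H t; rewrite le_max lexx => /(_ isT); apply/negP; rewrite -ltNge.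
have tt : (`|B| + 1) / `|a| <= t - t0 by rewrite lerBrDl le_max lexx orbT.
have c0 : 0 <= (`|B| + 1) / `|a| by rewrite divr_ge0// addr_ge0.
rewrite normrM ger0_norm ?(le_trans c0)//.
rewrite ler_pdivrMr// in tt; apply: lt_le_trans tt.
by rewrite (le_lt_trans (ler_norm _))// ltrDl.
Qed.

(** The maxima of [X - Y] and of [Y - X] do not increase, so the two motions stay at bounded
    distance. *)
Lemma velocity_unique X Y v w : crawling k G t0 X -> crawling k G t0 Y ->
  has_velocity X v -> has_velocity Y w -> v = w.
Proof.
move=> cX cY [BX [sX HX]] [BY [sY HY]].
pose C := `|topd X Y i0 t0| + `|topd Y X i0 t0|.
have XY t : t0 <= t -> `|X i0 t - Y i0 t| <= C.
  move=> tt; have h1 := topd_ge X Y i0 t i0; have h2 := topd_ge Y X i0 t i0.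
  have h3 := topd_nonincreasing k G k0 t0 _ _ cX cY i0 _ _ (lexx _) tt.
  have h4 := topd_nonincreasing k G k0 t0 _ _ cY cX i0 _ _ (lexx _) tt.
  have h5 := ler_norm (topd X Y i0 t0); have h6 := ler_norm (topd Y X i0 t0).
  have h7 := normr_ge0 (topd X Y i0 t0); have h8 := normr_ge0 (topd Y X i0 t0).
  by rewrite /C ler_norml; apply/andP; split; lra.
apply/eqP; rewrite -subr_eq0; apply/eqP.
apply: (@linear_bounded_eq0 _ (BX + BY + C) (Num.max t0 (Num.max sX sY))) => t.
rewrite !ge_max => /and3P[tt h1 h2].
have := HX i0 t h1; have := HY i0 t h2; have := XY t tt.
by rewrite !ler_norml; lra.
Qed.

Lemma crawling_solution Z : crawling k G t0 Z ->
  solution k G t0 (fun t => \row_i Z i t).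
Proof.
move=> cZ; have [LZ _ _ _] := cZ; split.
  have [K K0 LK] := Lip_uniform _ _ LZ.
  move=> b _ e e0; exists (e / K); first by rewrite divr_gt0.
  move=> n u v uv _; rewrite ltr_pdivlMr// => H; apply: le_lt_trans H.
  rewrite mulr_suml; apply: ler_sum => i _; have [_ uvi _] := uv i.
  have KM : 0 <= (v i - u i) * K by rewrite mulr_ge0 ?subr_ge0// ltW.
  rewrite [leLHS]/Num.Def.normr/= mx_normrE; apply: bigmax_le => //= -[a l] _.
  rewrite !mxE mulrC; apply: (le_trans (LK l _ _)).
  by rewrite ger0_norm ?subr_ge0.
have := ae_forall_fin _ _ (fun i => ae_derivable _ _ (LZ i)).
apply: ae_mono => t dZ tt.
have dx : derivable (fun t => \row_i Z i t) t 1.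
  apply/derivable_mxP => a i; rewrite (_ : (fun s => (\row_l Z l s) a i) = Z i)//.
  by apply/funext => s; rewrite mxE.
split => //; exists (- gradient (energy k G t) (\row_i Z i t)); last by rewrite /= subrr.
apply: dissipation_subdifferential => i; rewrite gradient_energyE.
have := crawling_incl k G t0 Z t i cZ tt (dZ i).
have -> : derive1 (fun t => \row_i Z i t) t 0 i = derive1 (Z i) t.
  rewrite derive1E derive_mx// mxE derive1E.
  by have -> : (fun t => (\row_i Z i t) 0 i) = Z i by apply/funext => s; rewrite mxE.
rewrite /forces.
by have -> : (fun l => (\row_i Z i t) 0 l) = (fun l => Z l t) by apply/funext => l; rewrite mxE.
Qed.

Lemma velocity_cvg (x : R -> 'rV[R]_N) v :
  has_velocity (fun i t => x (Num.max t t0) 0 i) v ->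
  (piY (x t) - piY (x t0)) / (t - t0) @[t --> +oo] --> v.
Proof.
move=> [B [s HB]]; have N0 : (0 : R) < N%:R by rewrite ltr0n (leq_ltn_trans _ (ltn_ord i0)).
have bound t : Num.max s t0 <= t -> `|piY (x t) - (t - t0) * v| <= B.
  rewrite ge_max => /andP[st tt].
  have -> : piY (x t) - (t - t0) * v = N%:R^-1 * \sum_i (x t 0 i - (t - t0) * v).
    rewrite sumrB sumr_const card_ord mulrBr /piY; congr (_ - _).
    by rewrite -[(_ * v) *+ _]mulr_natl mulKf// gt_eqF.
  rewrite normrM ger0_norm ?invr_ge0// mulrC ler_pdivrMr//.
  apply: (le_trans (ler_norm_sum _ _ _)).
  apply: (@le_trans _ _ (\sum_(i < N) B)); last by rewrite sumr_const card_ord -[X in X <= _]mulr_natr.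
  by apply: ler_sum => i _; have := HB i t st; rewrite max_l.
pose C := B + `|piY (x t0)| + 1.
have C0 : 0 < C.
  rewrite /C; have := bound (Num.max s t0) (lexx _).
  by move=> /(le_trans (normr_ge0 _)) h; have := normr_ge0 (piY (x t0)); lra.
apply/cvgrPdist_le => e e0; near=> t.
have h1 : Num.max s t0 <= t by near: t; apply: nbhs_pinfty_ge; exact: num_real.
have h2 : t0 + C / e <= t by near: t; apply: nbhs_pinfty_ge; exact: num_real.
have p : 0 < t - t0.
  by rewrite subr_gt0; apply: lt_le_trans h2; rewrite ltrDl divr_gt0.
have -> : v - (piY (x t) - piY (x t0)) / (t - t0) =
    - ((piY (x t) - (t - t0) * v) - piY (x t0)) / (t - t0).
  by field; rewrite gt_eqF.
rewrite mulNr normrN normrM normfV (gtr0_norm p) ler_pdivrMr//.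
apply: (le_trans (ler_normB _ _)).
have := bound t h1; rewrite -lerBrDl ler_pdivrMr// mulrC in h2.
rewrite /C in h2; lra.
Unshelve. all: by end_near. Qed.

Lemma sqrte_le (z : \bar R) (r : R) : 0 <= r -> (z <= (r ^+ 2)%:E)%E ->
  (sqrte z <= r%:E)%E.
Proof.
case: z => [z| |] r0 //=; rewrite ?lee_fin// => zr.
- by rewrite -(ger0_norm r0) -sqrtr_sqr ler_wsqrtr.
Qed.

Lemma W12norm_cvg0 (x : R -> 'rV[R]_N) Z v :
  let X := fun i t => x (Num.max t t0) 0 i in
  crawling k G t0 X -> crawling k G t0 Z -> relative_periodic Z v -> attracted X Z ->
  W12norm t0 (t0 + T) (fun t => x (t + q%:R * T) - \row_i Z i (t + q%:R * T))
    @[q --> \oo] --> 0%E.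
Proof.
move=> X cX cZ ZE XZ.
pose F q t := x (t + q%:R * T) - \row_i Z i (t + q%:R * T).
suff small e : 0 < e -> \forall q \near \oo, (W12norm t0 (t0 + T) (F q) <= e%:E)%E.
  have nn q : (0 <= W12norm t0 (t0 + T) (F q))%E by exact: sqrte_ge0.
  apply: cvg_EFin.
    have := small 1 ltr01; apply: filterS => q qP.
    by rewrite ge0_fin_numE; [exact: (le_lt_trans qP (ltry _))|exact: nn].
  apply/cvgrPdist_le => e e0; have := small e e0; apply: filterS => q qP.
  rewrite sub0r normrN /= ger0_norm; last by apply: fine_ge0; exact: nn.
  have fn : W12norm t0 (t0 + T) (F q) \is a fin_num.
    by rewrite ge0_fin_numE; [exact: (le_lt_trans qP (ltry _))|exact: nn].
  by rewrite -lee_fin fineK.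
move=> e0; have [LX _ _ _] := cX; have [LZ _ _ _] := cZ.
have [KX KX0 LKX] := Lip_uniform _ _ LX; have [KZ KZ0 LKZ] := Lip_uniform _ _ LZ.
pose K := KX + KZ; have K0 : 0 < K by exact: addr_gt0.
have LZK i : lip R K (Z i).
  by move=> s t; apply: (le_trans (LKZ i s t)); rewrite ler_wpM2r// lerDr ltW.
have LXK i : lip R K (X i).
  by move=> s t; apply: (le_trans (LKX i s t)); rewrite ler_wpM2r// lerDl ltW.
have t01 : t0 < t0 + T by rewrite ltrDl.
have e2 : 0 < e ^+ 2 by rewrite exprn_gt0.
have [eps eps0 H] := derivative_gap_small k G k0 t0 (t0 + T) K Z t01 K0 cZ LZK _ e2.
have [s ts sP] := XZ eps eps0.
exists (Num.truncn ((s - t0) / T)).+1 => // q /= sq.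
have {}sq : s <= t0 + q%:R * T.
  rewrite -lerBlDl -ler_pdivrMr//; apply: (le_trans (ltW (truncnS_gt _))).
  by rewrite ler_nat.
(* [eps] depends on [Z], so [Z] stays fixed and [X] is moved back by [q] periods; relative
   periodicity of [Z] makes [Y - Z] the shifted difference. *)
pose Y i t := X i (t + q%:R * T) + (- (q%:R * T * v)).
have qT0 : 0 <= q%:R * T by rewrite mulr_ge0// ltW.
have cY : crawling k G t0 Y.
  apply: (crawling_weaken k G (t0 - q%:R * T)); last exact: crawling_shift.
  by rewrite lerBlDr lerDl.
have LY i : lip R K (Y i).
  move=> r t; have -> : Y i r - Y i t = X i (r + q%:R * T) - X i (t + q%:R * T).
    by rewrite /Y; ring.
  have := LXK i (r + q%:R * T) (t + q%:R * T).
  by rewrite (_ : r + q%:R * T - (t + q%:R * T) = r - t)//; ring.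
have YZE i t : Y i t - Z i t = X i (t + q%:R * T) - Z i (t + q%:R * T).
  by rewrite /Y ZE; ring.
have YZ i t : t0 <= t -> `|Y i t - Z i t| <= eps.
  by move=> tt; rewrite YZE; apply: sP; apply: (le_trans sq); rewrite lerD2r.
have [rho [rhoi rhoe] aerho] := H Y cY LY YZ.
apply: sqrte_le; first exact: ltW.
have rhoe' : ((\int[lebesgue_measure]_(t in `[t0, t0 + T]) rho t)%:E <= (e ^+ 2)%:E)%E.
  by rewrite lee_fin.
apply: le_trans rhoe'; apply: ge0_integral_le_ae => //.
- move=> t; rewrite lee_fin addr_ge0// /dotv sumr_ge0// => i _; exact: sqr_ge0.
- have aeab : {ae lebesgue_measure, forall t : R, t != t0 /\ t != t0 + T}.
    exists [set t0; t0 + T]; split.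
    + by apply: measurableU; exact: measurable_set1.
    + by apply: countable_lebesgue_measure0; apply: finite_set_countable.
    + move=> t /= /not_andP[] /negP; rewrite negbK => /eqP ->; by [left|right].
  have := ae_conj _ _ aeab aerho; apply: ae_mono => t [[ta tb] Ht].
  rewrite /= in_itv/= => /andP[at_ t_b].
  have tab : t0 < t < t0 + T by rewrite !lt_neqAle at_ t_b tb eq_sym ta.
  have [w [dw wrho]] := Ht tab; rewrite lee_fin; apply: le_trans wrho.
  have FE r i : t0 <= r -> F q r 0 i = Y i r - Z i r.
    move=> tr; rewrite !mxE YZE /X max_l//.
    by rewrite (le_trans tr)// lerDl.
  have dF i : is_derive t 1 (fun r => F q r 0 i) (w i).
    apply: near_eq_is_derive (dw i); near=> r; rewrite FE//.
    have : r \in `]t0, t0 + T[ by near: r; apply: near_in_itvoo; rewrite in_itv.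
    by rewrite in_itv/= => /andP[/ltW].
  have dFm : derivable (F q) t 1.
    by apply/derivable_mxP => a i; rewrite (ord1 a); exact: (is_derive1_derivable _ _ _ (dF i)).
  rewrite /dotv -big_split/= le_eqVlt; apply/orP; left; apply/eqP.
  apply: eq_bigr => i _; rewrite -/(F q t) FE// -!expr2; congr (_ + _ ^+ 2).
  rewrite -/(F q) derive1E derive_mx// mxE -derive1E.
  exact: is_derive1E.
Unshelve. all: by end_near. Qed.

End Asymptotics.

Theorem theorem10 (R : realType) (N : nat) (hN : (2 <= N)%N)
    (k T : R) (hk : 0 < k) (hT : 0 < T) (G : gait N T) (t0 : R) :
  exists v0 : R, forall x : R -> 'rV[R]_N,
    solution k G t0 x -> admissible k G t0 (x t0) ->
    (piY (x t) - piY (x t0)) / (t - t0) @[t --> +oo] --> v0 /\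
    exists xbar : R -> 'rV[R]_N,
      [/\ solution k G t0 xbar,
          running_periodic T t0 v0 xbar &
          W12norm t0 (t0 + T)
            (fun t => x (t + q%:R * T) - xbar (t + q%:R * T))
          @[q --> \oo] --> 0%E].
Proof.
have i0 : 'I_N := Ordinal (ltnW hN).
pose clamp (x : R -> 'rV[R]_N) i t := x (Num.max t t0) 0 i.
(* [v0] has to be named before [x], so it is read off from one arbitrary solution; if there is none,
   the claim is vacuous. *)
have [[x1 sol1]|no_sol] := pselect (exists x, solution k G t0 x); last first.
  by exists 0 => x solx; case: no_sol; exists x.
have c1 := solution_crawling k G hk t0 x1 sol1.
have [Z1 [v0 [cZ1 ZE1 XZ1]]] := crawling_attractor k G hk hT t0 i0 _ c1.
exists v0 => x solx _.
have cX := solution_crawling k G hk t0 x solx.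
have [Z [v [cZ ZE XZ]]] := crawling_attractor k G hk hT t0 i0 _ cX.
have velZ : has_velocity t0 Z v.
  by have [LZ _ _ _] := cZ; exact: relative_periodic_velocity ZE.
have velX := attracted_velocity _ _ _ _ XZ velZ.
have velZ1 : has_velocity t0 Z1 v0.
  by have [LZ _ _ _] := cZ1; exact: relative_periodic_velocity ZE1.
have vE : v = v0.
  exact: (velocity_unique k G hk t0 i0 _ _ _ _ cX c1 velX (attracted_velocity _ _ _ _ XZ1 velZ1)).
rewrite -vE; split; first exact: velocity_cvg.
exists (fun t => \row_i Z i t); split.
- exact: crawling_solution.
(* The additive constant is absorbed into the periodic parts. *)
- exists 0, (fun i t => Z i t - (t - t0) * v); split.
    by move=> i t; have := ZE i t 1%N; rewrite mul1r => ->; ring.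
  by move=> t _ i; rewrite mxE; ring.
- exact: (W12norm_cvg0 k G hk hT t0 x Z v).
Qed.
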